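(* For a prime power $q$, let $G=\mathrm{PSL}_2(q)$ and let $P(G)$ be the probability that, for four elements $x_1,y_1,x_2,y_2$ chosen independently and uniformly at random from $G$, the quadruple $(x_1,y_1;x_2,y_2)$ is an unmixed Beauville structure for $G$. Then there exist real numbers $\epsilon_q$, indexed by the prime powers $q$, with $\epsilon_q\to 0$ as $q\to\infty$, such that: \begin{itemize} \item if $q$ is odd, then $\frac{1}{32}-\epsilon_q\le P(\mathrm{PSL}_2(q))\le \frac{15}{16}+\epsilon_q$; \item if $q$ is even, then $\frac{1}{32}-\epsilon_q\le P(\mathrm{PSL}_2(q))\le \frac{35}{36}+\epsilon_q$. \end{itemize}
   Context: An unmixed Beauville structure for a finite group $G$ is a quadruple $(x_1,y_1;x_2,y_2)$ of elements of $G$ which determines two triples $(x_1,y_1,z_1)$ and $(x_2,y_2,z_2)$ of elements of $G$ satisfying: (i) $x_1y_1z_1=1$ and $x_2y_2z_2=1$ (so $z_i=(x_iy_i)^{-1}$); (ii) $\langle x_1,y_1\rangle=G$ and $\langle x_2,y_2\rangle=G$; (iii) $\Sigma(x_1,y_1,z_1)\cap\Sigma(x_2,y_2,z_2)=\{1\}$, where $\Sigma(x,y,z)$ denotes the union of the conjugacy classes in $G$ of all powers of $x$, all powers of $y$ and all powers of $z$. Thus $P(G)=\#\{(x_1,y_1,x_2,y_2)\in G^4 : (x_1,y_1;x_2,y_2)\text{ is an unmixed Beauville structure for }G\}/|G|^4$. $\mathrm{PSL}_2(q)$ is the projective special linear group of degree $2$ over the finite field $\mathbb{F}_q$. *)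

(* Defs.v *)
From HB Require Import structures.
From mathcomp Require Import all_boot all_order all_algebra all_fingroup all_solvable.

Set Implicit Arguments.
Unset Strict Implicit.
Unset Printing Implicit Defensive.

Import GroupScope GRing.Theory.

Section Beauville.

Variable gT : finGroupType.
Implicit Types (G : {group gT}) (x y z : gT).

Definition beauville_Sigma G x y z : {set gT} :=
  \bigcup_(w in <[x]> :|: <[y]> :|: <[z]>) w ^: G.

(* z1 and z2 are determined by x_i * y_i * z_i = 1. *)
Definition unmixed_beauville G x1 y1 x2 y2 : bool :=
  let z1 := (x1 * y1)^-1 in
  let z2 := (x2 * y2)^-1 in
  [&& [&& x1 \in G, y1 \in G, x2 \in G & y2 \in G],
      <<[set x1; y1]>> == G,
      <<[set x2; y2]>> == G
    & beauville_Sigma G x1 y1 z1 :&: beauville_Sigma G x2 y2 z2 == [set 1]].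

Definition beauville_prob (R : unitRingType) G : R :=
  (#|[set t : gT * gT * gT * gT |
       let: (x1, y1, x2, y2) := t in unmixed_beauville G x1 y1 x2 y2]|%:R
   / #|G|%:R ^+ 4)%R.

End Beauville.

Section PSL2.

Variable F : finFieldType.

Definition SL2 : {set {'GL_2[F]}} := [set A | (\det (GLval A) == 1)%R].

Lemma SL2_group_set : group_set SL2.
Proof.
apply/group_setP; split=> [|A B]; rewrite !inE ?det1 //.
by move=> /eqP dA /eqP dB; rewrite det_mulmx dA dB mulr1.
Qed.

Canonical SL2_group := Group SL2_group_set.

(* Cosets of 'Z(SL2) are taken in the whole of GL_2, so PSL2 is a proper subset
   of its ambient type in general. *)
Definition PSL2 : {group coset_of 'Z(SL2)} := (SL2 / 'Z(SL2))%G.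

End PSL2.

Definition prime_power (q : nat) : Prop :=
  exists p k : nat, [/\ prime p, 0 < k & q = p ^ k]%N.

(* Main.v *)
(** Lower bound: a random element of SL2(q) is split or nonsplit with probability
    about 1/2 each, and the images in PSL2(q) of split (resp. nonsplit) elements
    have orders dividing (q-1)/d (resp. (q+1)/d), d = gcd(2, q-1).  These numbers
    are coprime, so a generating pair x, y with x, y, xy split together with a
    generating pair with x, y, xy nonsplit is a Beauville structure; each type of
    pair has probability about 1/8.  For a split x, diagonalised, the traces of y
    and xy determine the diagonal of y, which makes the split count explicit; the
    nonsplit count follows by inclusion-exclusion.

    Almost all pairs generate, without Dickson's classification: let x have order
    m and let y have no zero entry in an eigenbasis of x.  The map
    (i, j, k) |-> x^i y x^j y x^k has bounded fibres, so <x, y> has order at least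
    c m^3, and m > 4 q^(5/6) for almost all x by a divisor bound.  A subgroup this
    large meets a root subgroup nontrivially and the diagonal torus in a set whose
    squares generate the field F_q, hence contains all root subgroups.

    Upper bound: if q is odd, an element of trace t with 2 + t and 2 - t nonsquares
    has even order in PSL2(q), and involutions are conjugate; if q is even, an
    element whose trace is not of the form t^3 - 3t has order divisible by 3, and
    subgroups of order 3 are conjugate.  In both cases about a quarter of the
    traces at least are of this kind, so two such x1, x2 occur with probability at
    least about 1/16. *)
Require Import Defs.
From mathcomp Require Import all_boot all_order all_algebra all_fingroup all_solvable closed_field finfield.
From mathcomp Require Import zify ring lra.

Set Implicit Arguments.
Unset Strict Implicit.
Unset Printing Implicit Defensive.

Import Order.TTheory GRing.Theory Num.Theory.
Local Open Scope ring_scope.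

(** * Counting pairs and roots *)

Lemma card_sum_pair (A B : finType) (P : pred (A * B)) :
  #|[set t | P t]| = (\sum_(a : A) #|[set b : B | P (a, b)]|)%N.
Proof.
rewrite -sum1dep_card (eq_bigr (fun a => \sum_(b | P (a, b)) 1)%N) => [|a _].
  by rewrite pair_big_dep /=; apply: eq_bigl; case.
by rewrite sum1dep_card.
Qed.

Lemma card_roots_le (K : idomainType) (I : finType) (f : I -> K) (p : {poly K}) n :
  injective f -> p != 0 -> (size p <= n.+1)%N -> (#|[set i | root p (f i)]| <= n)%N.
Proof.
move=> inj_f p0 sz; rewrite -ltnS; apply: leq_trans sz.
rewrite cardE -(size_map f); apply: max_poly_roots => //; last by rewrite map_inj_uniq ?enum_uniq.
by apply/allP => x /mapP[i]; rewrite mem_enum inE => pi ->.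
Qed.

(** * Explicit 2 x 2 matrices *)

Section Mx2.
Variable R : comNzRingType.
Implicit Types (a b c d : R) (A B : 'M[R]_2).

Definition mx2 a b c d : 'M[R]_2 :=
  \matrix_(i, j) if i == 0 then (if j == 0 then a else b)
                 else (if j == 0 then c else d).

Lemma ord2P (i : 'I_2) : i = 0 \/ i = 1.
Proof. by case: i => [[|[|m]] lt_m2] //; [left | right]; apply: val_inj. Qed.

Lemma sum2 (V : nmodType) (f : 'I_2 -> V) : \sum_i f i = f 0 + f 1.
Proof. by rewrite big_ord_recl big_ord1; congr (f _ + f _); apply: val_inj. Qed.

Lemma mx2_eta A : A = mx2 (A 0 0) (A 0 1) (A 1 0) (A 1 1).
Proof.
by apply/matrixP=> i j; rewrite mxE; case: (ord2P i) => ->; case: (ord2P j) => ->.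
Qed.

Lemma mx2P A B :
  A 0 0 = B 0 0 -> A 0 1 = B 0 1 -> A 1 0 = B 1 0 -> A 1 1 = B 1 1 -> A = B.
Proof. by move=> e00 e01 e10 e11; rewrite (mx2_eta A) (mx2_eta B) e00 e01 e10 e11. Qed.

Lemma mul2E A B i j : (A *m B) i j = A i 0 * B 0 j + A i 1 * B 1 j.
Proof. by rewrite mxE sum2. Qed.

Lemma tr2E A : \tr A = A 0 0 + A 1 1.
Proof. exact: sum2. Qed.

Lemma det2E A : \det A = A 0 0 * A 1 1 - A 0 1 * A 1 0.
Proof.
rewrite (expand_det_row _ 0) sum2 /cofactor !det_mx11 !mxE /= expr0 expr1 mul1r.
by rewrite mulN1r mulrN; congr (_ * A _ _ - _ * A _ _); apply: val_inj.
Qed.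

Lemma mul_mx2 a b c d a' b' c' d' : mx2 a b c d *m mx2 a' b' c' d' =
  mx2 (a * a' + b * c') (a * b' + b * d') (c * a' + d * c') (c * b' + d * d').
Proof. by apply: mx2P; rewrite mul2E !mxE. Qed.

Lemma det_mx2 a b c d : \det (mx2 a b c d) = a * d - b * c.
Proof. by rewrite det2E !mxE. Qed.

Lemma tr_mx2 a b c d : \tr (mx2 a b c d) = a + d.
Proof. by rewrite tr2E !mxE. Qed.

Lemma one_mx2 : 1 = mx2 1 0 0 1.
Proof. by apply: mx2P; rewrite !mxE. Qed.

Lemma scalar_mx2 a : a%:M = mx2 a 0 0 a.
Proof. by apply: mx2P; rewrite !mxE. Qed.

Lemma cayley_hamilton2 A : \det A = 1 -> A *m A = \tr A *: A - 1%:M.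
Proof.
rewrite det2E => dA; apply: mx2P; rewrite mul2E tr2E !mxE /= ?mulr1n ?mulr0n;
  rewrite -?dA; ring.
Qed.

End Mx2.

(** * Coordinates on SL2(q) and counting elements by diagonal and by trace *)

Section SL2Basics.
Variable F : finFieldType.
Implicit Types (a b c d : F) (x y u : {'GL_2[F]}).

(** Falls back to the identity when the matrix is singular. *)
Definition sl2 a b c d : {'GL_2[F]} := insubd (1%g : {'GL_2[F]}) (mx2 a b c d).

Lemma sl2_val a b c d : a * d - b * c = 1 -> GLval (sl2 a b c d) = mx2 a b c d.
Proof.
move=> dA; rewrite /sl2 /GLval /insubd insubT // -/(unitmx _) unitmxE det_mx2 dA.
exact: unitr1.
Qed.

Lemma in_SL2 x : (x \in SL2 F) = (\det (GLval x) == 1).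
Proof. by rewrite inE. Qed.

Lemma sl2_in a b c d : a * d - b * c = 1 -> sl2 a b c d \in SL2 F.
Proof. by move=> dA; rewrite in_SL2 sl2_val // det_mx2 dA. Qed.

Lemma SL2_det x : x \in SL2 F ->
  GLval x 0 0 * GLval x 1 1 - GLval x 0 1 * GLval x 1 0 = 1.
Proof. by rewrite in_SL2 det2E => /eqP. Qed.

Lemma GLval_inj : injective (@GLval 2 F).
Proof. exact: val_inj. Qed.

Lemma sl2_eta x : x \in SL2 F ->
  x = sl2 (GLval x 0 0) (GLval x 0 1) (GLval x 1 0) (GLval x 1 1).
Proof. by move=> /SL2_det dx; apply: GLval_inj; rewrite sl2_val //; apply: mx2_eta. Qed.

Lemma card_mul_eq (k : F) :
  #|[set t : F * F | t.1 * t.2 == k]| = (#|F|.-1 + (k == 0%R) * #|F|)%N.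
Proof.
rewrite (card_sum_pair (fun t : F * F => t.1 * t.2 == k)) (bigD1 0) //= addnC; congr (_ + _)%N.
  rewrite (eq_bigr (fun _ => 1%N)) => [|a a0].
    by rewrite sum_nat_const muln1 cardC1.
  apply/eqP/cards1P; exists (k / a); apply/setP => b; rewrite !inE mulrC.
  by apply/eqP/eqP => [<- | ->]; rewrite ?mulfK ?mulfVK.
case: (eqVneq k 0) => [->|k0].
  by rewrite mul1n; apply: eq_card => b; rewrite inE mul0r eqxx.
by apply: eq_card0 => b; rewrite inE mul0r eq_sym (negPf k0).
Qed.

Lemma card_SL2_with (P : 'M[F]_2 -> bool) :
  #|[set x in SL2 F | P (GLval x)]| =
  (\sum_(s : F * F) #|[set t : F * F | ((t.1 * t.2 == s.1 * s.2 - 1)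
      && P (mx2 s.1 t.1 t.2 s.2))%R]|)%N.
Proof.
pose f (u : (F * F) * (F * F)) := sl2 u.1.1 u.2.1 u.2.2 u.1.2.
rewrite -(card_sum_pair (fun u : (F * F) * (F * F) => (u.2.1 * u.2.2 == u.1.1 * u.1.2 - 1)
      && P (mx2 u.1.1 u.2.1 u.2.2 u.1.2))).
rewrite -(@card_in_imset _ _ f [set t | _]).
  apply: eq_card => x; apply/idP/imsetP.
    rewrite inE => /andP[Gx Px].
    exists ((GLval x 0 0, GLval x 1 1), (GLval x 0 1, GLval x 1 0)); last exact: sl2_eta.
    by rewrite inE -(SL2_det Gx) /= -mx2_eta Px andbT; apply/eqP; ring.
  case=> [[[a d] [b c]]]; rewrite inE /= => /andP[/eqP dA PA] ->.
  have e: a * d - b * c = 1 by rewrite dA; ring.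
  by rewrite inE /f sl2_in //= sl2_val.
move=> [[a d] [b c]] [[a' d'] [b' c']]; rewrite !inE /f /=.
move=> /andP[/eqP dA _] /andP[/eqP dA' _] /(congr1 (@GLval 2 F)).
rewrite !sl2_val ?dA ?dA'; try ring.
move=> /matrixP eA.
by move: (eA 0 0) (eA 0 1) (eA 1 0) (eA 1 1); rewrite !mxE /= => -> -> -> ->.
Qed.

(** A diagonal (a, d) extends by the solutions (b, c) of bc = ad - 1: there are q - 1 of them, and q
    more when ad = 1. *)
Lemma card_SL2_diag (P : pred (F * F)) :
  #|[set x in SL2 F | P (GLval x 0 0, GLval x 1 1)]| =
  (#|[set s | P s]| * #|F|.-1 + #|[set s | P s && (s.1 * s.2 == 1)%R]| * #|F|)%N.
Proof.
rewrite (card_SL2_with (fun A => P (A 0 0, A 1 1))).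
rewrite -!sum1dep_card !big_distrl /= [RHS]addnC big_mkcondr /= -big_split /=.
rewrite [RHS]big_mkcond; apply: eq_bigr => -[a d] _ /=.
case: ifP => Pad.
  rewrite -subr_eq0 addnC mul1n; transitivity (#|F|.-1 + (a * d - 1 == 0)%R * #|F|)%N.
    by rewrite -card_mul_eq; apply: eq_card => t; rewrite !inE !mxE /= Pad andbT.
  by case: eqP.
by apply: eq_card0 => t; rewrite !inE !mxE /= Pad andbF.
Qed.

Lemma card_F_gt1 : (1 < #|F|)%N.
Proof. exact: finNzRing_gt1. Qed.

Lemma card_unit_pairs : #|[set s : F * F | s.1 * s.2 == 1]| = #|F|.-1.
Proof. by rewrite card_mul_eq oner_eq0 addn0. Qed.

Lemma card_SL2 : #|SL2 F| = (#|F| ^ 3 - #|F|)%N.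
Proof.
have := card_SL2_diag xpredT.
have -> : [set x in SL2 F | true] = SL2 F by apply/setP => x; rewrite inE andbT.
move=> ->; have -> : [set s : F * F | true] = setT by apply/setP => s; rewrite !inE.
rewrite cardsT card_prod card_unit_pairs; have := card_F_gt1.
case: #|F| => // q _ /=; rewrite !expnS expn0; nia.
Qed.

Lemma card_pairs_in (B C : {set F}) (f g : F * F -> F) :
    injective (fun s => (f s, g s)) ->
  #|[set s | (f s \in B) && (g s \in C)]| = (#|B| * #|C|)%N.
Proof.
move=> inj_fg; rewrite -cardsX -(card_preimset (setX B C) inj_fg).
by apply: eq_card => s; rewrite !inE.
Qed.

(** The |B| q diagonals with trace in B contribute q - 1 elements each. The q extra ones occur only
    for ad = 1, and for a fixed trace t the equation a (t - a) = 1 has at most two solutions a. *)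
Lemma card_trace_in (B : {set F}) :
  let N := #|[set x in SL2 F | \tr (GLval x) \in B]| in
  (#|B| * #|F| * #|F|.-1 <= N /\ N <= #|B| * #|F| * #|F|.+1)%N.
Proof.
pose P (s : F * F) := (s.1 \in [set: F]) && (s.1 + s.2 \in B).
move=> N; have -> : N = #|[set x in SL2 F | P (GLval x 0 0, GLval x 1 1)]|.
  by apply: eq_card => x; rewrite !inE /P /= inE tr2E.
rewrite card_SL2_diag (@card_pairs_in [set: F] B (fun s => s.1) (fun s => s.1 + s.2)); last first.
  by move=> [a d] [a' d'] /= [-> /addrI ->].
rewrite cardsT [(#|F| * _)%N]mulnC; set k := #|[set s | P s && _]|; split; first exact: leq_addr.
suff le_k: (k <= #|B| * 2)%N.
  have := leq_mul le_k (leqnn #|F|); have := card_F_gt1; case: #|F| => // q _ /=.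
  by clear; move: k #|B| => k b; nia.
rewrite /k; pose f (s : F * F) := (s.1 + s.2, s.1).
have inj_f : injective f by move=> [a d] [a1 d1] [e1 e2]; move: e1; rewrite e2 => /addrI ->.
rewrite -(card_imset _ inj_f) -sum_nat_const.
apply: (@leq_trans #|[set u : F * F | (u.1 \in B) && (u.2 * (u.1 - u.2) == 1)]|).
  apply: subset_leq_card; apply/subsetP => u /imsetP[[a d]]; rewrite !inE => /andP[/= sB ad] -> /=.
  by move: sB; rewrite /P inE /= => ->; rewrite addrC addKr ad.
rewrite (card_sum_pair (fun u : F * F => (u.1 \in B) && (u.2 * (u.1 - u.2) == 1))) big_mkcond /=.
rewrite [leqRHS]big_mkcond; apply: leq_sum => t _; case: ifP => tB; last first.
  by rewrite eq_card0 // => b; rewrite inE.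
pose p : {poly F} := 'X * (t%:P - 'X) - 1.
have szp : size p = 3%N.
  rewrite /p mulrBr -[_ - 1]opprK opprD opprK size_polyN addrC.
  have -> : 1 - ('X * t%:P - 'X * 'X) = 'X^2 + (1 - t *: 'X) :> {poly F}.
    by rewrite -mul_polyC mulrC; ring.
  rewrite size_polyDl ?size_polyXn // ltnS.
  apply: leq_trans (size_polyD _ _) _; rewrite geq_max size_poly1 size_polyN /=.
  by apply: leq_trans (size_scale_leq _ _) _; rewrite size_polyX.
apply: leq_trans (@card_roots_le _ _ id p 2 _ _ _); rewrite ?szp //.
  apply: subset_leq_card; apply/subsetP => b; rewrite !inE /= /root !hornerE => /eqP ->.
  by rewrite subrr.
by rewrite -size_poly_gt0 szp.
Qed.

End SL2Basics.

Lemma card_le_fibre (S T : finType) (A : {set S}) (B : {set T}) (f : S -> T) n :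
    {in A, forall s, f s \in B} ->
    (forall t, t \in B -> #|[set s in A | f s == t]| <= n)%N ->
  (#|A| <= n * #|B|)%N.
Proof.
move=> fAB le_n; rewrite -sum1_card (partition_big f (mem B)) //= mulnC -sum_nat_const.
by apply: leq_sum => t Bt; rewrite sum1dep_card le_n.
Qed.

(** The polynomial is given by its coefficients, constant term first, so that [horner_rec] unfolds
    to an explicit expression and the only side condition is a nonzero last coefficient. *)
Lemma card_horner_rec (K : idomainType) (I : finType) (f : I -> K) (s : seq K) n :
    injective f -> size s = n.+1 -> s`_n != 0 ->
  (#|[set i | horner_rec s (f i) == 0%R]| <= n)%N.
Proof.
move=> inj_f sz sn; apply: leq_trans (@card_roots_le K I f (Poly s) n inj_f _ _).
- by apply: subset_leq_card; apply/subsetP => i; rewrite !inE /root horner_Poly.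
- by apply: contraNneq sn => p0; rewrite -coef_Poly p0 coef0.
by rewrite -sz size_Poly.
Qed.

(** * Diagonalisation of 2 x 2 matrices of determinant 1 *)

Section Diagonalization.
Variable K : fieldType.
Implicit Types (A P : 'M[K]_2) (l : K).

(** As l and l^-1 are distinct, the characteristic polynomial splits with simple roots. The first
    diagonal entry gets a new name m because the order of the two eigenvalues is not controlled. *)
Lemma diagonalize2 A l : \det A = 1 -> l != 0 -> l + l^-1 = \tr A -> l ^+ 2 != 1 ->
  exists P m, [/\ P \in unitmx, m != 0, m ^+ 2 != 1
    & P *m A *m invmx P = mx2 m 0 0 m^-1].
Proof.
move=> dA l0 tA l2.
have [|P uP] := (diagonalizableP A).2.
  exists [:: l; l^-1].
    rewrite /= inE andbT; apply: contraNneq l2 => ll.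
    by apply/eqP; rewrite expr2 -[X in _ * X]invrK -ll mulfV.
  apply: dvdp_trans (mxminpoly_dvd_char _) _.
  suff -> : char_poly A = \prod_(x <- [:: l; l^-1]) ('X - x%:P) by [].
  rewrite big_cons big_seq1 /char_poly det2E !mxE /= !mulr1n !mulr0n.
  rewrite !sub0r mulrNN mulrBl !mulrBr opprB -!polyCM.
  move: dA tA; rewrite det2E tr2E => dA tA.
  transitivity ('X * 'X - 'X * (A 0 0 + A 1 1)%:P
     + (A 0 0 * A 1 1 - A 0 1 * A 1 0)%:P : {poly K}).
    by rewrite polyCD polyCB !polyCM; ring.
  by rewrite dA -tA -(mulfV l0) polyCD polyCM; ring.
rewrite /similar_to /= => /is_diag_mxP; rewrite conjumx // => Ddiag.
set D := P *m A *m invmx P in Ddiag.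
have D01 : D 0 1 = 0 by apply: Ddiag.
have D10 : D 1 0 = 0 by apply: Ddiag.
have dD : \det D = 1 by rewrite !det_mulmx mulrAC -det_mulmx mulmxV // det1 mul1r.
have tD : \tr D = l + l^-1 by rewrite mxtrace_mulC mulmxA mulVmx // mul1mx.
move: dD tD; rewrite det2E tr2E D01 D10 mul0r subr0 => dD tD.
have D00 : D 0 0 != 0 by apply: contra_eq_neq dD => ->; rewrite mul0r eq_sym oner_eq0.
have D11 : D 1 1 = (D 0 0)^-1 by rewrite -[RHS]mulr1 -dD mulKf.
exists P, (D 0 0); split=> //; last by rewrite -D11 [LHS]mx2_eta D01 D10.
apply: contraNneq l2 => D2.
have e1 : (D 0 0)^-1 = D 0 0 by rewrite -[RHS](mulfK D00) -expr2 D2 mul1r.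
(* If m = m^-1 then l + l^-1 = 2m, so l is a double root equal to m and l^2 = 1. *)
have: (l - D 0 0) ^+ 2 == 0.
  apply/eqP; transitivity (l * (l + l^-1) - (1 + 1) * l * D 0 0 + 1 - (l * l^-1) + (D 0 0 ^+ 2 - 1)).
    by ring.
  by rewrite -tD D11 e1 D2 mulfV //; ring.
by rewrite expf_eq0 /= subr_eq0 => /eqP ->; apply/eqP.
Qed.

(* The left-hand column is determined by the right-hand one when the matrix
   maps a given line, not spanned by the second basis vector, to a given line. *)
Lemma column_determined (a b c d a' c' u0 u1 v0 v1 : K) :
    a * d - b * c = 1 -> a' * d - b * c' = 1 -> v0 != 0 -> (u0 != 0) || (u1 != 0) ->
    u0 * (a * v0 + b * v1) + u1 * (c * v0 + d * v1) = 0 ->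
    u0 * (a' * v0 + b * v1) + u1 * (c' * v0 + d * v1) = 0 ->
  a = a' /\ c = c'.
Proof.
move=> dA dA' v00 u0n e1 e2; pose s := a * (c - c') - c * (a - a').
have ea : a - a' = b * s.
  have h : (a - a') * d = b * (c - c') by rewrite mulrBl mulrBr -[a * d](subrK (b * c)) dA
    -[a' * d](subrK (b * c')) dA'; ring.
  by rewrite -[LHS]mulr1 -dA /s; transitivity (a * ((a - a') * d) - (a - a') * (b * c)); [ring | rewrite h; ring].
have ec : c - c' = d * s.
  have h : b * (c - c') = (a - a') * d by rewrite mulrBl mulrBr -[a * d](subrK (b * c)) dA
    -[a' * d](subrK (b * c')) dA'; ring.
  by rewrite -[LHS]mulr1 -dA /s; transitivity (a * d * (c - c') - c * (b * (c - c'))); [ring | rewrite h; ring].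
suff s0 : s = 0 by move: ea ec; rewrite s0 !mulr0 => /eqP + /eqP; rewrite !subr_eq0 => /eqP + /eqP.
apply/eqP; apply: contraT => s0; move: u0n.
have h1 : u0 * b + u1 * d = 0.
  have : v0 * s * (u0 * b + u1 * d) = 0.
    transitivity (v0 * (u0 * (b * s) + u1 * (d * s))); first by ring.
    by rewrite -ea -ec -[RHS](subrr 0) -{1}e1 -e2; ring.
  by move/eqP; rewrite !mulf_eq0 (negPf v00) (negPf s0) => /eqP.
have h2 : u0 * a + u1 * c = 0.
  have : v0 * (u0 * a + u1 * c) = 0 by rewrite -[RHS]e1; transitivity (v0 * (u0 * a + u1 * c) + v1 * (u0 * b + u1 * d)); [rewrite h1; ring | ring].
  by move/eqP; rewrite !mulf_eq0 (negPf v00) => /eqP.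
have -> : u0 = 0 by rewrite -[LHS]mulr1 -dA; transitivity (d * (u0 * a + u1 * c) - c * (u0 * b + u1 * d)); [ring | rewrite h1 h2; ring].
have -> : u1 = 0 by rewrite -[LHS]mulr1 -dA; transitivity (a * (u0 * b + u1 * d) - b * (u0 * a + u1 * c)); [ring | rewrite h1 h2; ring].
by rewrite eqxx.
Qed.

End Diagonalization.

(** * Passing to an eigenbasis over an extension field; a cubic lower bound for subgroup orders *)

Section Conjugation.
Variables (F : finFieldType) (K : fieldType) (phi : {rmorphism F -> K}) (P : 'M[K]_2).
Hypothesis uP : P \in unitmx.
Implicit Types (x y : {'GL_2[F]}).

Definition cj x : 'M[K]_2 := P *m map_mx phi (GLval x) *m invmx P.

Lemma cjM x y : cj (x * y)%g = cj x *m cj y.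
Proof. by rewrite /cj -!mulmxA mulKmx // !mulmxA -[in RHS](mulmxA P) -map_mxM. Qed.

Lemma cj_inj : injective cj.
Proof.
move=> x y /(congr1 (fun A => invmx P *m A *m P)); rewrite /cj !mulmxA !mulVmx // !mul1mx.
by rewrite !mulmxKV // => /map_mx_inj /GLval_inj.
Qed.

Lemma cj1 : cj 1%g = 1.
Proof. by rewrite /cj map_mx1 mulmx1 mulmxV. Qed.

Lemma cj_expg x l : cj x = mx2 l 0 0 l^-1 ->
  forall n, cj (x ^+ n)%g = mx2 (l ^+ n) 0 0 (l ^- n).
Proof.
move=> cx; elim=> [|n IHn]; first by rewrite cj1 one_mx2 expr0 invr1.
rewrite expgS cjM IHn cx mul_mx2 !mulr0 !mul0r !addr0 !add0r -exprS.
by congr mx2; rewrite -invfM -exprS.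
Qed.

Lemma cj_det x : x \in SL2 F -> \det (cj x) = 1.
Proof.
rewrite in_SL2 => /eqP dx.
by rewrite !det_mulmx mulrAC -det_mulmx mulmxV // det1 mul1r det_map_mx dx rmorph1.
Qed.

Lemma cj_tr x : \tr (cj x) = phi (\tr (GLval x)).
Proof. by rewrite mxtrace_mulC mulmxA mulVmx // mul1mx trace_map_mx. Qed.

(** A vanishing entry says that x maps the line of column j of P^-1 into the kernel of row i of P.
    Such an x is determined by one of its columns, which takes at most q^2 values. *)
Lemma card_cj_entry0 (i j : 'I_2) :
  (#|[set x in SL2 F | cj x i j == 0%R]| <= #|F| ^ 2)%N.
Proof.
pose Q := invmx P.
have cjE x : cj x i j = P i 0 * (phi (GLval x 0 0) * Q 0 j + phi (GLval x 0 1) * Q 1 j)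
   + P i 1 * (phi (GLval x 1 0) * Q 0 j + phi (GLval x 1 1) * Q 1 j).
  by rewrite /cj -mulmxA !mul2E !mxE.
have uQ : Q \in unitmx by rewrite unitmx_inv.
have nzu : (P i 0 != 0) || (P i 1 != 0).
  apply: contraLR uP => /norP[/negPn/eqP P0 /negPn/eqP P1].
  rewrite unitmxE det2E; case: (ord2P i) P0 P1 => -> -> ->;
  by rewrite ?mul0r ?mulr0 subrr unitr0.
have nzv : (Q 0 j != 0) || (Q 1 j != 0).
  apply: contraLR uQ => /norP[/negPn/eqP Q0 /negPn/eqP Q1].
  rewrite unitmxE det2E; case: (ord2P j) Q0 Q1 => -> -> ->;
  by rewrite ?mul0r ?mulr0 subrr unitr0.
have phi_det x : x \in SL2 F -> phi (GLval x 0 0) * phi (GLval x 1 1)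
    - phi (GLval x 0 1) * phi (GLval x 1 0) = 1.
  by move=> /SL2_det; rewrite -!rmorphM -rmorphB => ->; rewrite rmorph1.
have le_col k : (forall x y, x \in SL2 F -> y \in SL2 F -> cj x i j = 0 -> cj y i j = 0 ->
     GLval x 0 k = GLval y 0 k -> GLval x 1 k = GLval y 1 k -> x = y) ->
  (#|[set x in SL2 F | cj x i j == 0%R]| <= #|F| ^ 2)%N.
  move=> inj_k; rewrite -(@card_in_imset _ _ (fun x => (GLval x 0 k, GLval x 1 k))).
    by rewrite (leq_trans (max_card _)) // card_prod.
  by move=> x y; rewrite !inE => /andP[Gx /eqP cx] /andP[Gy /eqP cy] [e0 e1]; apply: inj_k;
     rewrite ?in_SL2.
(* Here the line is spanned by the second basis vector, so the two columns exchange roles; the signs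
   keep the determinant equal to 1. *)
have [v0 | v0] := eqVneq (Q 0 j) 0.
  rewrite v0 eqxx /= in nzv; apply: (le_col 0) => x y Gx Gy; rewrite !cjE => cx cy e0 e1.
  rewrite -e0 -e1 in cy.
  have dx := phi_det _ Gx; have dy := phi_det _ Gy; rewrite -e0 -e1 in dy.
  case: (@column_determined K (phi (GLval x 0 1)) (- phi (GLval x 0 0)) (phi (GLval x 1 1))
    (- phi (GLval x 1 0)) (phi (GLval y 0 1)) (phi (GLval y 1 1)) (P i 0) (P i 1) (Q 1 j)
    (- Q 0 j)) => //.
  - by rewrite -dx; ring.
  - by rewrite -dy; ring.
  - by rewrite -cx; ring.
  - by rewrite -cy; ring.
  by move=> /fmorph_inj e2 /fmorph_inj e3; apply: GLval_inj; apply: mx2P.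
apply: (le_col 1) => x y Gx Gy; rewrite !cjE => cx cy e0 e1; rewrite -e0 -e1 in cy.
have dx := phi_det _ Gx; have dy := phi_det _ Gy; rewrite -e0 -e1 in dy.
case: (column_determined dx dy v0 nzu cx cy) => /fmorph_inj e2 /fmorph_inj e3.
by apply: GLval_inj; apply: mx2P.
Qed.

(** The map (i, j, k) |-> x^i y x^j y x^k has fibres of size at most 8 once at most 4 values of j
    are discarded. In the eigenbasis the product of the diagonal entries of the image depends on j
    alone and leaves at most 4 values of j; the product of the first-row entries then gives l^(2i),
    hence at most two i; the corner entry gives k. *)
Lemma order_cube_le (H : {group {'GL_2[F]}}) x y l :
    x \in H -> y \in H -> l != 0 -> cj x = mx2 l 0 0 l^-1 ->
    (forall i j, cj y i j != 0) ->
  (#[x]%g ^ 2 * (#[x]%g - 4) <= 8 * #|H|)%N.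
Proof.
move=> Hx Hy l0 cx cy0; set m := #[x]%g.
pose pw (i : 'I_m) := l ^+ i; have pw0 i : pw i != 0 by apply: expf_neq0.
have inj_pw : injective pw.
  move=> i j eij; apply/val_inj/eqP; rewrite /= -(modn_small (ltn_ord i)) -(modn_small (ltn_ord j)).
  rewrite -[_ == _]/(_ == _ %[mod #[x]%g]) -eq_expg_mod_order; apply/eqP/cj_inj.
  by rewrite !(cj_expg cx) -[l ^+ i]/(pw i) eij.
set a := cj y 0 0; set b := cj y 0 1; set c := cj y 1 0; set d := cj y 1 1.
have cy : cj y = mx2 a b c d by apply: mx2_eta.
have [a0 b0 c0 d0] : [/\ a != 0, b != 0, c != 0 & d != 0] by split; apply: cy0.
(* The quartic is, up to the factor b / e^2, the product [M0 e * M1 e] defined below; its roots are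
   the j for which a first-row entry of the image vanishes. *)
pose J0 := [set j | horner_rec [:: b * c * d; 0; a ^+ 2 * d + b * c * a; 0; a ^+ 3] (pw j) == 0].
have J0_le : (#|J0| <= 4)%N by apply: card_horner_rec; rewrite // expf_neq0.
pose T : {set 'I_m * 'I_m * 'I_m} := setX (setX (~: J0) setT) setT.
have T_ge : (m ^ 2 * (m - 4) <= #|T|)%N.
  rewrite !cardsX cardsT card_ord -mulnA mulnC expnS expn1 leq_mul2r.
  apply/orP; right; rewrite leq_subLR -[leqLHS](card_ord m) -(cardsC J0).
  by rewrite leq_add2r.
apply: leq_trans T_ge _.
pose f (t : 'I_m * 'I_m * 'I_m) := (x ^+ t.1.2 * y * x ^+ t.1.1 * y * x ^+ t.2)%g.
apply: (@card_le_fibre _ _ T H f) => [t _|r _]; first by rewrite !groupM ?groupX.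
pose M0 (e : K) := a ^+ 2 * e + b * c / e.
pose M1 (e : K) := a * b * e + b * d / e.
pose M3 (e : K) := b * c * e + d ^+ 2 / e.
have cf t : cj (f t) = mx2 (pw t.1.2 * pw t.2 * M0 (pw t.1.1))
    (pw t.1.2 / pw t.2 * M1 (pw t.1.1))
    ((pw t.1.2)^-1 * pw t.2 * (a * c * pw t.1.1 + c * d / pw t.1.1))
    ((pw t.1.2)^-1 / pw t.2 * M3 (pw t.1.1)).
  rewrite /f !cjM !(cj_expg cx) cy !mul_mx2 -/(pw t.1.1) -/(pw t.1.2) -/(pw t.2) /M0 /M1 /M3.
  by congr mx2; ring.
have M01n e : e != 0 -> M0 e * M1 e =
   b * horner_rec [:: b * c * d; 0; a ^+ 2 * d + b * c * a; 0; a ^+ 3] e / e ^+ 2.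
  by move=> e0; rewrite /M0 /M1 /=; field.
(* The numerator of [M0 e * M3 e] minus the product of the diagonal entries of r; the leading
   coefficient a^2 b c is nonzero because y has no zero entry. *)
pose Jr := [set j | horner_rec [:: b * c * d ^+ 2; 0;
    a ^+ 2 * d ^+ 2 + (b * c) ^+ 2 - cj r 0 0 * cj r 1 1; 0; a ^+ 2 * (b * c)] (pw j) == 0].
have Jr_le : (#|Jr| <= 4)%N by apply: card_horner_rec; rewrite // !mulf_neq0 ?expf_neq0.
pose S := [set s : 'I_m * 'I_m | (s.1 \in Jr) &&
   (pw s.2 ^+ 2 == cj r 0 0 * cj r 0 1 / (M0 (pw s.1) * M1 (pw s.1)))].
have S_le : (#|S| <= 8)%N.
  rewrite card_sum_pair; apply: (@leq_trans (\sum_(j in Jr) 2)%N); last first.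
    by rewrite sum_nat_const -[8%N]/(4 * 2)%N leq_mul2r.
  rewrite [leqRHS]big_mkcond /=; apply: leq_sum => j _; case: ifP => jJ; last first.
    by rewrite eq_card0 // => i; rewrite inE.
  set e := cj r 0 0 * cj r 0 1 / _; apply: (@leq_trans #|[set i | horner_rec [:: - e; 0; 1] (pw i) == 0]|).
    apply: subset_leq_card; apply/subsetP => i; rewrite !inE /= => /eqP <-.
    by apply/eqP; ring.
  by apply: card_horner_rec; rewrite // oner_neq0.
apply: leq_trans S_le; rewrite -(@card_in_imset _ _ (fun t => t.1) [set t in T | f t == r]).
  apply: subset_leq_card; apply/subsetP => s /imsetP[[[j i] k]]; rewrite !inE /= => /andP[].
  rewrite !andbT => jJ /eqP fr -> /=; rewrite -fr cf /= !mxE /=.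
  have nM : M0 (pw j) * M1 (pw j) != 0.
    by rewrite M01n // !mulf_neq0 ?invr_neq0 ?expf_neq0 //; move: jJ; rewrite inE.
  apply/andP; split; apply/eqP; last first.
    move: nM (pw0 i) (pw0 k); move: (M0 (pw j)) (M1 (pw j)) (pw i) (pw k) => u v p1 p2.
    by rewrite mulf_eq0 negb_or => /andP[u0 v0] p10 p20; field; rewrite u0 v0 p20.
  rewrite /M0 /M3; move: (pw0 j) (pw0 i) (pw0 k); move: (pw j) (pw i) (pw k) => e p1 p2 e0 p10 p20.
  by field; rewrite e0 p10 p20.
move=> [[j i] k] [[j' i'] k']; rewrite !inE /= !andbT => /andP[jJ /eqP fr] /andP[_ /eqP fr'].
move=> [ej ei]; subst j' i'; congr (_, _); apply: inj_pw.
have: cj (f (j, i, k)) 0 0 = cj (f (j, i, k')) 0 0 by rewrite fr fr'.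
rewrite !cf !mxE /=.
have nM : M0 (pw j) != 0.
  have: M0 (pw j) * M1 (pw j) != 0.
    by rewrite M01n // !mulf_neq0 ?invr_neq0 ?expf_neq0 //; move: jJ; rewrite inE.
  by rewrite mulf_eq0 => /norP[].
by move=> /(mulIf nM) /(mulfI (pw0 i)).
Qed.

End Conjugation.

(** * Large subgroups of SL2(q) are the whole group *)

Section LargeSubgroups.
Variable F : finFieldType.
Implicit Types (a b c d l : F) (H : {group {'GL_2[F]}}).
Local Notation q := #|F|.

Lemma GLvalM (x y : {'GL_2[F]}) : GLval (x * y)%g = GLval x *m GLval y.
Proof. by []. Qed.

Lemma sl2M a b c d a' b' c' d' : a * d - b * c = 1 -> a' * d' - b' * c' = 1 ->
  (sl2 a b c d * sl2 a' b' c' d')%g =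
  sl2 (a * a' + b * c') (a * b' + b * d') (c * a' + d * c') (c * b' + d * d').
Proof.
move=> dA dA'; apply: GLval_inj; rewrite GLvalM !sl2_val // ?mul_mx2 //.
transitivity ((a * d - b * c) * (a' * d' - b' * c')); first by ring.
by rewrite dA dA' mulr1.
Qed.

Lemma sl2_1 : sl2 1 0 0 1 = 1%g :> {'GL_2[F]}.
Proof. by apply: GLval_inj; rewrite sl2_val -?one_mx2 //; ring. Qed.

Definition uni b := sl2 1 b 0 1.
Definition low b := sl2 1 0 b 1.
Definition dia l := sl2 l 0 0 l^-1.

Lemma det_uni b : 1 * 1 - b * 0 = 1 :> F. Proof. by ring. Qed.
Lemma det_low b : 1 * 1 - 0 * b = 1 :> F. Proof. by ring. Qed.
Lemma det_dia l : l != 0 -> l * l^-1 - 0 * 0 = 1.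
Proof. by move=> l0; rewrite mulfV //; ring. Qed.

Lemma uniM b b' : (uni b * uni b')%g = uni (b + b')%R.
Proof. by rewrite /uni sl2M ?det_uni //; congr sl2; ring. Qed.

Lemma diaM l l' : l != 0 -> l' != 0 -> (dia l * dia l')%g = dia (l * l')%R.
Proof.
by move=> l0 l0'; rewrite /dia sl2M ?det_dia // invfM; congr sl2; ring.
Qed.

Lemma dia_uni l b : l != 0 -> (dia l * uni b)%g = (uni (l ^+ 2 * b)%R * dia l)%g.
Proof.
by move=> l0; rewrite /dia /uni !sl2M ?det_dia ?det_uni //; congr sl2; field.
Qed.

Lemma uni_inj : injective uni.
Proof.
by move=> b b' /(congr1 (@GLval 2 F)); rewrite !sl2_val ?det_uni // => /matrixP/(_ 0 1); rewrite !mxE.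
Qed.

Lemma dia_inj : {in [set l | l != 0] &, injective dia}.
Proof.
move=> l l'; rewrite !inE => l0 l0' /(congr1 (@GLval 2 F)).
by rewrite !sl2_val ?det_dia // => /matrixP/(_ 0 0); rewrite !mxE.
Qed.

Lemma uni_group_set : group_set [set uni b | b in [set: F]].
Proof.
apply/group_setP; split=> [|x y]; first by apply/imsetP; exists 0; rewrite ?inE // -sl2_1.
by move=> /imsetP[b _ ->] /imsetP[b' _ ->]; rewrite uniM imset_f ?inE.
Qed.
Definition uni_group := Group uni_group_set.

Lemma dia_group_set : group_set [set dia l | l in [set l | l != 0]].
Proof.
apply/group_setP; split=> [|x y].
  by apply/imsetP; exists 1; rewrite ?inE ?oner_eq0 // -sl2_1 /dia invr1.
move=> /imsetP[l +->] /imsetP[l' +->]; rewrite !inE => l0 l0'.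
by rewrite diaM // imset_f // inE mulf_neq0.
Qed.
Definition dia_group := Group dia_group_set.

Lemma card_setI_ge (G H A : {group {'GL_2[F]}}) : A \subset G -> H \subset G ->
  (#|A| * #|H| <= #|G| * #|A :&: H|)%N.
Proof.
move=> sAG sHG; rewrite mul_cardG leq_mul2r subset_leq_card ?orbT //.
by rewrite mul_subG.
Qed.

(** E is a subfield, since e^-1 = e^(q-2). If f were outside E, then (e1, e2) |-> e1 + e2 f would
    embed E x E into F, so that |E|^2 <= q. *)
Lemma subring_eqT (E : {set F}) : 1 \in E ->
    {in E &, forall e f, e - f \in E} -> {in E &, forall e f, e * f \in E} ->
  (q < #|E| ^ 2)%N -> E = setT.
Proof.
move=> E1 EB EM ltE; apply/eqP; rewrite eqEsubset subsetT /=; apply/subsetP => f _.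
apply: contraT => Ef; move: ltE; rewrite ltnNge => /negP[].
have E0 : 0 \in E by rewrite -(subrr 1) EB.
have EX n e : e \in E -> e ^+ n \in E.
  by move=> Ee; elim: n => [|n IHn]; rewrite ?expr0 // exprS EM.
have EV e : e \in E -> e^-1 \in E.
  move=> Ee; have [->|e0] := eqVneq e 0; first by rewrite invr0.
  suff -> : e^-1 = e ^+ q.-2 by apply: EX.
  apply: (mulfI e0); rewrite mulfV // -exprS; apply: (mulfI e0); rewrite mulr1 -exprS.
  by have := expf_card e; have := card_F_gt1 F; case: q => [|[]] // n _ /= ->.
rewrite -mulnn -cardsX -(@card_in_imset _ _ (fun s => s.1 + s.2 * f)); first exact: max_card.
move=> [e1 e2] [f1 f2]; rewrite !inE /= => /andP[Ee1 Ee2] /andP[Ef1 Ef2] eq_ef.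
have e2f2 : e2 = f2.
  apply/eqP; rewrite -subr_eq0; apply: contraNT Ef => ef0.
  suff -> : f = (f1 - e1) * (e2 - f2)^-1 by rewrite EM ?EB ?EV ?EB.
  apply: (mulIf ef0); rewrite mulfVK //.
  by transitivity (e1 + e2 * f - e1 - f2 * f); [ring | rewrite eq_ef; ring].
by move: eq_ef; rewrite e2f2 => /addIr ->.
Qed.

(** The set V of root-subgroup parameters in H is additive, and conjugation by a torus element
    [dia l] of H multiplies it by l^2. The first bound makes V nonzero. The second makes the
    multiplier ring E of V, which contains these squares, larger than sqrt q, hence all of F; so V =
    F. *)
Lemma uni_sub H : H \subset SL2 F -> (#|SL2 F| < q * #|H|)%N ->
  (4 * q * #|SL2 F| ^ 2 < (q.-1 * #|H|) ^ 2)%N -> forall b, uni b \in H.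
Proof.
move=> sHG lt1 lt2.
pose V := [set b | uni b \in H].
(* The value l = 0 is excluded because [dia 0] is the identity by default. *)
pose L := [set l | (l != 0) && (dia l \in H)].
pose E := [set e | [forall b in V, e * b \in V]].
have EP e b : e \in E -> b \in V -> e * b \in V by rewrite inE => /forall_inP; apply.
have V_N b : b \in V -> - b \in V.
  rewrite !inE => Hb; suff -> : uni (- b) = (uni b)^-1%g by rewrite groupV.
  by apply: (mulgI (uni b)); rewrite mulgV uniM subrr -sl2_1.
have V_D b b' : b \in V -> b' \in V -> b + b' \in V.
  by rewrite !inE -uniM; apply: groupM.
(* Squaring maps L into E and is at most two-to-one. *)
have sLE : (#|L| <= 2 * #|E|)%N.
  apply: (@card_le_fibre _ _ L E (fun l => l ^+ 2)) => [l|e _].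
    rewrite inE => /andP[l0 Hl]; rewrite inE; apply/forall_inP => b; rewrite !inE => Hb.
    by rewrite -[uni _](mulgK (dia l)) -dia_uni // !groupM ?groupV.
  apply: leq_trans (@card_horner_rec _ _ id [:: - e; 0; 1] 2 _ _ _); rewrite ?oner_neq0 //.
  apply: subset_leq_card; apply/subsetP => l; rewrite !inE => /andP[_ /eqP <-] /=.
  by apply/eqP; ring.
have cardV : #|uni_group :&: H| = #|V|.
  rewrite -(card_imset _ uni_inj); apply: eq_card => x; rewrite inE.
  apply/andP/imsetP => [[/imsetP[b _ ->] Hb]|[b]]; first by exists b; rewrite ?inE.
  by rewrite inE => Hb ->; rewrite imset_f ?inE.
have cardL : #|dia_group :&: H| = #|L|.
  rewrite -(@card_in_imset _ _ dia L); last first.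
    by move=> l l'; rewrite !inE => /andP[l0 _] /andP[l0' _]; apply: dia_inj; rewrite inE.
  apply: eq_card => x; rewrite inE.
  apply/andP/imsetP => [[/imsetP[l l0 ->] Hb]|[l]]; first by exists l => //; rewrite !inE in l0 *; apply/andP.
  by rewrite inE => /andP[l0 Hl] ->; rewrite imset_f ?inE.
have cardU : #|uni_group| = q by rewrite card_imset ?cardsT //; apply: uni_inj.
have cardD : #|dia_group| = q.-1.
  rewrite (card_in_imset dia_inj) -(cardC1 (0 : F)); by apply: eq_card => l; rewrite !inE.
have sUG : uni_group \subset SL2_group F.
  by apply/subsetP => _ /imsetP[b _ ->]; rewrite sl2_in ?det_uni.
have sDG : dia_group \subset SL2_group F.
  by apply/subsetP => x /imsetP[l l0 ->]; rewrite inE in l0; rewrite sl2_in ?det_dia.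
have geV := card_setI_ge sUG sHG; have geL := card_setI_ge sDG sHG.
rewrite cardU cardV /= in geV; rewrite cardD cardL /= in geL.
have [b0 Vb0 b00] : exists2 b, b \in V & b != 0.
  have: (1 < #|V|)%N.
    by have := leq_trans lt1 geV; case: #|V| => [|[]] //; rewrite ?muln0 ?muln1 ?ltnn.
  by move=> /card_gt1P[b [b' [Vb Vb' bb']]]; have [b_0|] := eqVneq b 0; [exists b' | exists b];
     rewrite // -b_0 eq_sym.
have ET : E = setT.
  apply: subring_eqT.
  - by rewrite inE; apply/forall_inP => b; rewrite mul1r.
  - move=> e f Ee Ef; rewrite inE; apply/forall_inP => b Vb.
    by rewrite mulrBl V_D ?V_N ?EP.
  - by move=> e f Ee Ef; rewrite inE; apply/forall_inP => b Vb; rewrite -mulrA !EP.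
  rewrite ltnNge; apply: contraL lt2 => leE; rewrite -leqNgt.
  apply: (@leq_trans ((#|SL2 F| * (2 * #|E|)) ^ 2)).
    by rewrite leq_sqr (leq_trans geL) // leq_mul2l sLE orbT.
  by rewrite !expnMn [leqRHS]mulnC leq_mul2l leq_mul2l leE !orbT.
move=> b; suff: b \in V by rewrite inE.
by rewrite -[b](mulfVK b00) EP // ET inE.
Qed.

(** If c is nonzero, the matrix is a product upper, lower, upper. If c = 0, splitting off [low (-1)]
    on the right leaves a matrix with lower left entry d, which is nonzero. *)
Lemma SL2_gen H : (forall b, uni b \in H) -> (forall b, low b \in H) -> SL2 F \subset H.
Proof.
move=> Hu Hl; have Hc a b c d : a * d - b * c = 1 -> c != 0 -> sl2 a b c d \in H.
  move=> dA c0; have -> : sl2 a b c d = (uni ((a - 1) / c)%R * low c * uni ((d - 1) / c)%R)%g.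
    rewrite /uni /low !sl2M ?det_uni ?det_low //; last by field.
    have -> : b = (a * d - 1) / c by rewrite -dA; field.
    by congr sl2; field.
  by rewrite !groupM.
apply/subsetP => x Gx; rewrite (sl2_eta Gx); have := SL2_det Gx.
move: (GLval x 0 0) (GLval x 0 1) (GLval x 1 0) (GLval x 1 1) => a b c d dA.
have [c0|] := eqVneq c 0; last exact: Hc.
rewrite c0 mulr0 subr0 in dA *.
have d0 : d != 0 by apply: contra_eq_neq dA => ->; rewrite mulr0 eq_sym oner_eq0.
have -> : sl2 a b 0 d = (sl2 (a + b)%R b d d * low (-1)%R)%g.
  by rewrite /low sl2M ?det_low //; [congr sl2; ring | rewrite -dA; ring].
by rewrite groupM // Hc //; rewrite -dA; ring.
Qed.

Lemma large_subgroup H : H \subset SL2 F -> (#|SL2 F| < q * #|H|)%N ->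
  (4 * q * #|SL2 F| ^ 2 < (q.-1 * #|H|) ^ 2)%N -> H :=: SL2 F.
Proof.
move=> sHG lt1 lt2; apply/eqP; rewrite eqEsubset sHG.
apply: SL2_gen; first exact: uni_sub.
(* The Weyl element swaps the two root subgroups, so the lower one is handled by the conjugate of H
   under w. *)
pose w : {'GL_2[F]} := sl2 0 1 (-1) 0.
have dw : 0 * 0 - 1 * -1 = 1 :> F by ring.
have Gw : w \in SL2_group F by apply: sl2_in.
move=> b; have: uni (- b) \in (H :^ w)%G.
  by apply: uni_sub; rewrite ?cardJg // -(conjGid Gw) conjSg.
suff -> : uni (- b) = (low b ^ w)%g by rewrite memJ_conjg.
rewrite conjgE; apply: (mulgI w); rewrite mulKVg /w /uni /low !sl2M ?det_uni ?det_low //.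
by congr sl2; ring.
Qed.

End LargeSubgroups.

(** * Almost all pairs generate SL2(q) *)

Lemma card_has_le (T : finType) (I : eqType) (P : I -> pred T) (s : seq I) :
  (#|[set t | has (P^~ t) s]| <= \sum_(i <- s) #|[set t | P i t]|)%N.
Proof.
elim: s => [|i s IHs]; first by rewrite big_nil leqn0 cards_eq0; apply/eqP/setP => t; rewrite !inE.
rewrite big_cons; apply: leq_trans (leq_add (leqnn _) IHs).
apply: leq_trans (leq_card_setU _ _); apply: subset_leq_card.
by apply/subsetP => t; rewrite !inE.
Qed.

Section Generation.
Variable F : finFieldType.
Local Notation q := #|F|.
Local Notation g := #|SL2 F|.
Implicit Types (x y : {'GL_2[F]}).

Lemma add_inv_inj (K : fieldType) (k m : K) : k != 0 -> m != 0 ->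
  k + k^-1 = m + m^-1 -> k = m \/ k = m^-1.
Proof.
move=> k0 m0 kE; have : (k - m) * (k - m^-1) == 0.
  apply/eqP; transitivity (k * (k - (m + m^-1)) + m * m^-1); first by ring.
  by rewrite -kE mulfV //; transitivity (1 - k * k^-1); [ring | rewrite mulfV // subrr].
by rewrite mulf_eq0 !subr_eq0 => /orP[] /eqP ->; [left | right].
Qed.

Lemma closed_trace (K : closedFieldType) (t : K) :
  exists l : K, (l != 0) && (l + l^-1 == t).
Proof.
have [l] : exists l, root ('X^2 - t *: 'X + 1) l.
  apply/closed_rootP; rewrite -addrA size_polyDl ?size_polyXn //.
  apply: leq_ltn_trans (size_polyD _ _) _; rewrite gtn_max size_poly1 size_polyN.
  by rewrite (leq_ltn_trans (size_scale_leq _ _)) // size_polyX.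
rewrite /root !hornerE => /eqP tl; exists l.
have l0 : l != 0 by apply: contra_eq_neq tl => ->; rewrite expr0n mulr0 subr0 add0r oner_eq0.
rewrite l0 /= -(inj_eq (mulfI l0)) mulrDr mulfV // -subr_eq0 -tl.
by apply/eqP; ring.
Qed.

Lemma trace_sqr_eq4 (K : fieldType) (l : K) : l != 0 -> l ^+ 2 = 1 -> (l + l^-1) ^+ 2 = 4%:R.
Proof.
move=> l0 l2; have -> : l^-1 = l by rewrite -[RHS](mulfK l0) -expr2 l2 mul1r.
by transitivity (4%:R * l ^+ 2); [ring | rewrite l2 mulr1].
Qed.

Lemma regular_diag (K : closedFieldType) (phi : {rmorphism F -> K}) x :
    x \in SL2 F -> (\tr (GLval x)) ^+ 2 != 4%:R ->
  exists P m, [/\ P \in unitmx, m != 0, m ^+ 2 != 1 & cj phi P x = mx2 m 0 0 m^-1].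
Proof.
rewrite in_SL2 => /eqP dx tx; have [l /andP[l0 /eqP tE]] := closed_trace (phi (\tr (GLval x))).
apply: (@diagonalize2 K _ l); rewrite ?det_map_mx ?dx ?rmorph1 ?trace_map_mx //.
apply: contraNneq tx => l2; rewrite -(inj_eq (fmorph_inj phi)) rmorphXn rmorph_nat -tE.
by rewrite trace_sqr_eq4.
Qed.

Lemma card_irregular : (#|[set t : F | t ^+ 2 == 4%:R]| <= 2)%N.
Proof.
apply: leq_trans (@card_horner_rec _ _ id [:: - 4%:R; 0; 1] 2 _ _ _); rewrite ?oner_neq0 //.
by apply: subset_leq_card; apply/subsetP => t; rewrite !inE /= => /eqP <-; apply/eqP; ring.
Qed.

(** The order d of x divides g, and an eigenvalue of x is a d-th root of unity. Each divisor d <= M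
    thus allows at most d traces, and each trace is shared by at most q (q + 1) elements. *)
Lemma card_small_order (M : nat) :
  (#|[set x in SL2 F | ((\tr (GLval x)) ^+ 2 != 4%:R)%R && (#[x]%g <= M)]| <=
     size (divisors g) * M * q * q.+1)%N.
Proof.
have [K [phi _]] := countable_algebraic_closure F.
(* h t is a chosen eigenvalue, in the algebraic closure, of the matrices of trace t. *)
have /all_sig[h hP] (t : F) : {l : K | (l != 0) && (l + l^-1 == phi t)}.
  exact: sigW (closed_trace _).
have h0 t : h t != 0 by case/andP: (hP t).
have hE t : h t + (h t)^-1 = phi t by case/andP: (hP t) => _ /eqP.
have inj_h : injective h by move=> s t est; apply: (fmorph_inj phi); rewrite -!hE est.
pose P d := [pred t : F | (d <= M)%N && (h t ^+ d == 1)].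
pose B := [set t | has (P^~ t) (divisors g)].
have leB : (#|B| <= size (divisors g) * M)%N.
  apply: leq_trans (card_has_le _ _) _; rewrite -sum1_size big_distrl /=.
  rewrite !big_seq; apply: leq_sum => d; rewrite -dvdn_divisors ?cardG_gt0 // => dvd_d.
  rewrite mul1n; rewrite /P; have [dM | Md] := leqP d M; last first.
    by rewrite eq_card0 // => t; rewrite !inE.
  have d0 : (0 < d)%N by apply: dvdn_gt0 dvd_d; apply: cardG_gt0.
  apply: leq_trans dM; apply: leq_trans (@card_roots_le K F h ('X^d - 1) d inj_h _ _).
  - by apply: subset_leq_card; apply/subsetP => t; rewrite !inE /root !hornerE subr_eq0.
  - by rewrite -size_poly_gt0 size_XnsubC.
  by rewrite size_XnsubC.
apply: (@leq_trans #|[set x in SL2 F | \tr (GLval x) \in B]|); last first.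
  by apply: leq_trans (card_trace_in B).2 _; rewrite !leq_mul2r leB !orbT.
apply: subset_leq_card; apply/subsetP => x; rewrite !inE => /and3P[dx tx xM].
rewrite dx; have Gx : x \in SL2 F by rewrite in_SL2.
have [Q [m [uQ m0 m2 cx]]] := regular_diag phi Gx tx.
apply/hasP; exists #[x]%g; first by rewrite -dvdn_divisors ?cardG_gt0 // order_dvdG.
rewrite /= xM /=; have : cj phi Q (x ^+ #[x])%g = 1 by rewrite expg_order cj1.
rewrite (cj_expg uQ cx) => /matrixP/(_ 0 0); rewrite !mxE /= => mx.
have tm : h (\tr (GLval x)) + (h (\tr (GLval x)))^-1 = m + m^-1.
  by rewrite hE -(cj_tr phi uQ) cx tr_mx2.
case: (add_inv_inj (h0 _) m0 tm) => ->; first by rewrite mx.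
by rewrite exprVn mx invr1.
Qed.

(** With m the order of x, m > M >= 8 gives m - 4 >= m / 2, so h = |<x, y>| satisfies M^3 < 16 h. As
    4^6 = 16^3, the hypothesis on M becomes h^2 > 16 q^5, which implies both size conditions of
    [large_subgroup]. *)
Lemma order_large_generate (M : nat) x y :
    (4 ^ 6 * q ^ 5 < M ^ 6)%N -> (M < #[x]%g)%N ->
    (exists (K : fieldType) (phi : {rmorphism F -> K}) P m,
      [/\ P \in unitmx, m != 0, cj phi P x = mx2 m 0 0 m^-1
        & forall i j, cj phi P y i j != 0]) ->
  x \in SL2 F -> y \in SL2 F -> <<[set x; y]>>%g = SL2 F.
Proof.
move=> ltM ltx [K [phi [P [m [uP m0 cx cy]]]]] Gx Gy.
have sHG : <<[set x; y]>>%g \subset SL2_group F by rewrite gen_subG subUset !sub1set Gx.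
have Hx : x \in <<[set x; y]>>%g by rewrite mem_gen ?inE ?eqxx.
have Hy : y \in <<[set x; y]>>%g by rewrite mem_gen ?inE ?eqxx ?orbT.
have := order_cube_le uP Hx Hy m0 cx cy.
have q1 := card_F_gt1 F.
set h := #|_| => leh.
(* 7^6 = 117649 is below 4^6 * 2^5 = 131072. *)
have M8 : (8 <= M)%N.
  rewrite leqNgt; apply/negP => M7; move: ltM; rewrite ltnNge => /negP[].
  apply: (@leq_trans (7 ^ 6)%N); first by rewrite leq_exp2r.
  by apply: (@leq_trans (4 ^ 6 * 2 ^ 5)%N); rewrite // leq_mul2l leq_exp2r // q1.
have M3 : (M ^ 3 < 16 * h)%N.
  apply: (@leq_trans (#[x]%g ^ 3)%N); first by rewrite ltn_exp2r.
  move: leh ltx; move: #[x]%g => n; rewrite !expnS !expn0 => leh ltx; nia.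
have h2 : (16 * q ^ 5 < h ^ 2)%N.
  suff : (16 * 16 * (16 * q ^ 5) < 16 * 16 * h ^ 2)%N by rewrite ltn_mul2l => /andP[].
  have -> : (16 * 16 * h ^ 2 = (16 * h) ^ 2)%N by rewrite expnMn.
  rewrite mulnA; apply: ltn_trans ltM _.
  by rewrite -[6%N]/(3 * 2)%N expnM ltn_exp2r.
apply: (@large_subgroup F <<[set x; y]>>%G); rewrite ?card_SL2 -/h //.
  have : (q ^ 2 < h)%N.
    rewrite -(@ltn_exp2r _ _ 2) // -expnM; apply: leq_ltn_trans h2.
    by rewrite [(q ^ 5)%N]expnS mulnA leq_pmull // muln_gt0 /= ltnW.
  by rewrite -[3%N]/(1 + 2)%N expnD => lth; rewrite (leq_ltn_trans (leq_subr _ _)) // ltn_mul2l ltnW.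
apply: (@leq_ltn_trans (4 * q * (q ^ 3) ^ 2)%N).
  by rewrite leq_mul2l leq_exp2r // leq_subr orbT.
(* Uses q <= 2 (q - 1). *)
apply: (@leq_ltn_trans (q.-1 ^ 2 * (16 * q ^ 5))%N).
  have -> : (4 * q * (q ^ 3) ^ 2 = 4 * q ^ 2 * q ^ 5)%N by rewrite -expnM -mulnA -expnS -mulnA -expnD.
  rewrite mulnA leq_mul2r; apply/orP; right; rewrite -!mulnn.
  by case: q q1 => // n; rewrite /=; nia.
by rewrite expnMn ltn_mul2l h2 andbT expn_gt0; case: q q1 => // -[].
Qed.

(** The first term counts the x of trace 2 or -2 and those of order at most M, with y arbitrary. For
    any other x, at most 4 q^2 elements y have a zero entry in an eigenbasis of x. *)
Lemma card_nongenerating (M : nat) : (4 ^ 6 * q ^ 5 < M ^ 6)%N ->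
  (#|[set s : {'GL_2[F]} * {'GL_2[F]} |
      [&& s.1 \in SL2 F, s.2 \in SL2 F & <<[set s.1; s.2]>>%g != SL2 F]]| <=
     (2 + size (divisors g) * M) * q * q.+1 * g + g * (4 * q ^ 2))%N.
Proof.
move=> ltM.
pose X := [set x in SL2 F | ((\tr (GLval x)) ^+ 2 == 4%:R) || (#[x]%g <= M)%N].
have leX : (#|X| <= (2 + size (divisors g) * M) * q * q.+1)%N.
  pose B := [set t : F | t ^+ 2 == 4%:R].
  pose Y := [set x in SL2 F | ((\tr (GLval x)) ^+ 2 != 4%:R) && (#[x]%g <= M)%N].
  apply: (@leq_trans (#|[set x in SL2 F | \tr (GLval x) \in B]| + #|Y|)).
    apply: leq_trans (leq_card_setU _ _); apply: subset_leq_card; apply/subsetP => x.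
    by rewrite !inE => /andP[-> ] /=; case: eqP.
  rewrite 2!mulnDl; apply: leq_add (card_small_order M).
  apply: leq_trans (card_trace_in B).2 _.
  by rewrite !leq_mul2r card_irregular !orbT.
rewrite card_sum_pair /=.
rewrite (bigID (mem X)) /=; apply: leq_add.
  apply: leq_trans (_ : #|X| * g <= _)%N; last by rewrite leq_mul2r leX orbT.
  rewrite -sum_nat_const; apply: leq_sum => x _; apply: subset_leq_card.
  by apply/subsetP => y; rewrite !inE => /and3P[].
apply: (@leq_trans (\sum_(x in SL2 F) (4 * q ^ 2))%N); last by rewrite sum_nat_const.
rewrite big_mkcond [leqRHS]big_mkcond; apply: leq_sum => x _ /=.
case: ifP => // Xx; case: ifP => Gx; last by rewrite eq_card0 // => y; rewrite !inE.
move: Xx; rewrite inE Gx /= negb_or -ltnNge => /andP[tx ltx].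
have [K [phi _]] := countable_algebraic_closure F.
have [P [m [uP m0 m2 cx]]] := regular_diag phi Gx tx.
pose Z i j := [set y in SL2 F | cj phi P y i j == 0].
apply: (@leq_trans #|(Z 0 0 :|: Z 0 1) :|: (Z 1 0 :|: Z 1 1)|).
  apply: subset_leq_card; apply/subsetP => y; rewrite !inE => /andP[Gy].
  rewrite Gy /=; apply: contraNT; rewrite !negb_or => /andP[/andP[c00 c01] /andP[c10 c11]].
  apply/eqP; apply: (order_large_generate ltM ltx) => //; last by rewrite in_SL2.
  exists K, phi, P, m; split=> // i j.
  by case: (ord2P i) => ->; case: (ord2P j) => ->.
have leZ i j : (#|Z i j| <= q ^ 2)%N by apply: card_cj_entry0.
apply: leq_trans (leq_card_setU _ _) _.
apply: leq_trans (leq_add (leq_card_setU _ _) (leq_card_setU _ _)) _.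
by rewrite -[4%N]/(2 + 2)%N mulnDl !mul2n -!addnn !leq_add.
Qed.

End Generation.

(** * The divisor bound: the number of divisors of n is O(n^(1/k)) for every k *)

Section DivisorBound.
Local Open Scope nat_scope.

(** The map d |-> (gcd(d, m), d / gcd(d, m)) is an injection into the pairs of divisors, inverted by
    multiplication. *)
Lemma size_divisorsM m n : 0 < m -> 0 < n ->
  size (divisors (m * n)) <= size (divisors m) * size (divisors n).
Proof.
move=> m0 n0; rewrite -(size_allpairs muln); apply: uniq_leq_size (divisors_uniq _) _ => d.
rewrite -dvdn_divisors ?muln_gt0 ?m0 // => dvd_d.
have g0 : 0 < gcdn d m by rewrite gcdn_gt0 m0 orbT.
apply/allpairsP; exists (gcdn d m, d %/ gcdn d m) => /=.
rewrite -!dvdn_divisors // dvdn_gcdr mulnC divnK ?dvdn_gcdl //; split=> //.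
rewrite -(@Gauss_dvdr _ (m %/ gcdn d m)).
  by rewrite -(dvdn_pmul2r g0) mulnAC !divnK ?dvdn_gcdl ?dvdn_gcdr.
by rewrite /coprime -(eqn_pmul2r g0) muln_gcdl !divnK ?dvdn_gcdl ?dvdn_gcdr // mul1n.
Qed.

Lemma size_divisors_pfactor p a : prime p -> size (divisors (p ^ a)) <= a.+1.
Proof.
move=> pr_p; rewrite -[a.+1](size_iota 0) -(size_map (expn p) (iota _ _)).
apply: uniq_leq_size (divisors_uniq _) _ => d.
rewrite -dvdn_divisors ?expn_gt0 ?prime_gt0 // => /(dvdn_pfactor _ _ pr_p)[j le_ja ->].
by rewrite map_f // mem_iota.
Qed.

(** a + 1 <= k (a/k + 1) <= k 2^(a/k), where a/k is the integer quotient. *)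
Lemma expSn_le k a : 0 < k -> a.+1 ^ k <= k ^ k * 2 ^ a.
Proof.
move=> k0; apply: (@leq_trans ((k * 2 ^ (a %/ k)) ^ k)).
  rewrite leq_exp2r //; apply: (@leq_trans (k * (a %/ k).+1)).
    by rewrite mulnC ltn_ceil.
  by rewrite leq_mul2l ltn_expl ?orbT.
by rewrite expnMn -expnM leq_mul2l leq_exp2l // leq_divM orbT.
Qed.

(** Strip off one prime power p^a at a time. If p >= 2^k then (a + 1)^k <= 2^(ka) <= p^a costs
    nothing; a smaller prime costs the factor k^k, and at most 2^k primes are that small. *)
Lemma size_divisors_exp_le k : 0 < k ->
  exists c, forall n, 0 < n -> size (divisors n) ^ k <= c * n.
Proof.
move=> k0; pose c0 := k ^ k; have c0_gt0 : 0 < c0 by rewrite expn_gt0 k0.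
pose S n := [set p : 'I_(2 ^ k) | prime p && (p %| n)].
suff le_n n : 0 < n -> size (divisors n) ^ k <= c0 ^ #|S n| * n.
  exists (c0 ^ (2 ^ k)) => n n0; apply: leq_trans (le_n n n0) _.
  by rewrite leq_mul2r leq_pexp2l ?orbT // -[leqRHS]card_ord max_card.
have [N] := ubnP n; elim: N n => // N IHN n le_nN n0.
have [n1 | n1] := leqP n 1.
  have -> : n = 1 by apply/eqP; rewrite eqn_leq n1.
  by rewrite exp1n muln1 expn_gt0 c0_gt0.
pose p := pdiv n; have pr_p : prime p by apply: pdiv_prime.
have [m cop_pm def_n] := pfactor_coprime pr_p n0.
set a := logn p n in def_n.
have a0 : 0 < a by rewrite logn_gt0 mem_primes pr_p n0 pdiv_dvd.
have p0 : 0 < p by apply: prime_gt0.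
have m0 : 0 < m by move: n0; rewrite def_n muln_gt0 => /andP[].
have lt_mn : m < n.
  by rewrite def_n -[X in X < _]muln1 ltn_mul2l m0 -(exp1n a) ltn_exp2r // prime_gt1.
have IHm := IHN m (leq_trans lt_mn le_nN) m0.
have sSmn : S m \subset S n.
  apply/subsetP => r; rewrite !inE => /andP[-> dvd_r] /=.
  by rewrite def_n dvdn_mulr.
apply: (@leq_trans (a.+1 ^ k * (c0 ^ #|S m| * m))).
  rewrite {1}def_n mulnC; apply: leq_trans (_ : (a.+1 * size (divisors m)) ^ k <= _).
    rewrite leq_exp2r //; apply: leq_trans (size_divisorsM _ _) _; rewrite ?expn_gt0 ?p0 //.
    by rewrite leq_mul2r size_divisors_pfactor ?orbT.
  by rewrite expnMn leq_mul2l IHm orbT.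
have [lt_p | le_p] := ltnP p (2 ^ k).
  have lt_S : #|S m| < #|S n|.
    apply: proper_card; rewrite properE sSmn; apply/subsetPn; exists (Ordinal lt_p).
      by rewrite !inE /= pr_p pdiv_dvd.
    by rewrite !inE /= pr_p -prime_coprime // cop_pm.
  apply: (@leq_trans (c0 * p ^ a * (c0 ^ #|S m| * m))).
    rewrite leq_mul2r; apply/orP; right; apply: leq_trans (expSn_le _ k0) _.
    by rewrite leq_mul2l leq_exp2r ?prime_gt1 ?orbT.
  rewrite {2}def_n mulnACA -expnS [p ^ a * m]mulnC leq_mul2r.
  by rewrite leq_pexp2l ?orbT.
apply: (@leq_trans (p ^ a * (c0 ^ #|S m| * m))).
  rewrite leq_mul2r; apply/orP; right; apply: (@leq_trans ((2 ^ k) ^ a)).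
    by rewrite -expnM mulnC expnM leq_exp2r // ltn_expl.
  by rewrite leq_exp2r.
rewrite {2}def_n mulnCA [p ^ a * m]mulnC leq_mul2r leq_pexp2l ?orbT //.
exact: subset_leq_card.
Qed.

End DivisorBound.

(** * Inclusion-exclusion for the events x in A, y in A, xy in A *)

Section GroupPairs.
Variables (gT : finGroupType) (G : {group gT}) (A : {set gT}).
Hypothesis sAG : A \subset G.
Local Notation g := #|G|.

Lemma sum_mem_mulr x : x \in G -> (\sum_(y in G) (x * y \in A)%g = #|A|)%N.
Proof.
move=> Gx; rewrite -(card_lcoset A x^-1) -sum1_card big_mkcond [RHS]big_mkcond.
apply: eq_bigr => y _; rewrite mem_lcoset invgK; case: ifP => // Gy.
by case: ifP => // /(subsetP sAG); rewrite groupMl // Gy.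
Qed.

Lemma sum_mem_mull y : y \in G -> (\sum_(x in G) (x * y \in A)%g = #|A|)%N.
Proof.
move=> Gy; rewrite -(card_rcoset A y^-1) -sum1_card big_mkcond [RHS]big_mkcond.
apply: eq_bigr => x _; rewrite mem_rcoset invgK; case: ifP => // Gx.
by case: ifP => // /(subsetP sAG); rewrite groupMr // Gx.
Qed.

Lemma sum_mem : (\sum_(x in G) (x \in A) = #|A|)%N.
Proof.
rewrite -sum1_card big_mkcond [RHS]big_mkcond; apply: eq_bigr => x _.
by case: ifP => [_|Gx]; case: ifP => // /(subsetP sAG); rewrite Gx.
Qed.

(** The three events are pairwise independent: each holds for |G| |A| pairs and any two of them for
    |A|^2 pairs. Only the triple intersection remains as an unknown sum. *)
Lemma sum_indicator_pairs :
  (\sum_(x in G) \sum_(y in G) [&& x \notin A, y \notin A & x * y \notin A]%g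
   + \sum_(x in G) \sum_(y in G) [&& x \in A, y \in A & x * y \in A]%g
   + 3 * (g * #|A|) = g ^ 2 + 3 * #|A| ^ 2)%N.
Proof.
have E1 : (\sum_(x in G) \sum_(y in G) (x \in A) = g * #|A|)%N.
  by rewrite -sum_mem big_distrr; apply: eq_bigr => x _; rewrite sum_nat_const.
have E2 : (\sum_(x in G) \sum_(y in G) (y \in A) = g * #|A|)%N.
  by rewrite -sum_nat_const; apply: eq_bigr => x _; rewrite sum_mem.
have E3 : (\sum_(x in G) \sum_(y in G) (x * y \in A)%g = g * #|A|)%N.
  by rewrite -sum_nat_const; apply: eq_bigr => x Gx; rewrite sum_mem_mulr.
have E4 : (\sum_(x in G) \sum_(y in G) (x \in A) * (y \in A) = #|A| ^ 2)%N.
  rewrite -mulnn -[X in (X * _)%N]sum_mem big_distrl /=; apply: eq_bigr => x _.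
  by rewrite -sum_mem big_distrr.
have E5 : (\sum_(x in G) \sum_(y in G) (x \in A) * (x * y \in A)%g = #|A| ^ 2)%N.
  rewrite -mulnn -[X in (X * _)%N]sum_mem big_distrl /=; apply: eq_bigr => x Gx.
  by rewrite -(sum_mem_mulr Gx) big_distrr.
have E6 : (\sum_(x in G) \sum_(y in G) (y \in A) * (x * y \in A)%g = #|A| ^ 2)%N.
  rewrite exchange_big -mulnn -[X in (X * _)%N]sum_mem big_distrl /=; apply: eq_bigr => x Gx.
  by rewrite -(sum_mem_mull Gx) big_distrr.
have E0 : (\sum_(x in G) \sum_(y in G) 1 = g ^ 2)%N.
  by rewrite -mulnn -[RHS]sum_nat_const; apply: eq_bigr => x _; rewrite sum1_card.
rewrite -[(3 * (g * _))%N]/(g * #|A| + (g * #|A| + (g * #|A| + 0)))%N addn0.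
rewrite -{1}E1 -{1}E2 -E3 -[(3 * _ ^ 2)%N]/(#|A| ^ 2 + (#|A| ^ 2 + (#|A| ^ 2 + 0)))%N addn0.
rewrite -{1}E4 -{1}E5 -E6 -E0 -!big_split; apply: eq_bigr => x _ /=.
rewrite -!big_split; apply: eq_bigr => y _ /=.
by case: (x \in A); case: (y \in A); case: (x * y \in A)%g.
Qed.

End GroupPairs.

(** * Split and nonsplit elements *)

Section Splitting.
Variable F : finFieldType.
Local Notation q := #|F|.
Local Notation g := #|SL2 F|.
Implicit Types (x y : {'GL_2[F]}) (t l : F).

Definition tr x := \tr (GLval x).
(** The traces of determinant 1 matrices with two distinct eigenvalues in F. The set [irr_tr] below
    consists of 2 and -2, the traces with a repeated eigenvalue; all other traces have their
    eigenvalues outside F. *)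
Definition split_tr : {set F} :=
  (fun l : F => l + l^-1) @: [set l : F | (l != 0) && (l ^+ 2 != 1)].
Definition irr_tr := [set t : F | t ^+ 2 == 4%:R].
Definition split_el := [set x in SL2 F | tr x \in split_tr].
Definition nonsplit_el := [set x in SL2 F | tr x \notin split_tr :|: irr_tr].

(** l |-> l + l^-1 is exactly two-to-one on L, which omits from F only 0, 1 and -1. *)
Lemma card_split_tr : (q <= 2 * #|split_tr| + 3 /\ 2 * #|split_tr| <= q.-1)%N.
Proof.
pose L := [set l : F | (l != 0) && (l ^+ 2 != 1)].
have in_fib (l k : F) : l \in L -> k \in L -> k + k^-1 = l + l^-1 -> k = l \/ k = l^-1.
  by rewrite !inE => /andP[l0 _] /andP[k0 _]; apply: add_inv_inj.
have LE : (#|L| <= q.-1)%N.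
  rewrite -(cardC1 (0 : F)); apply: subset_leq_card; apply/subsetP => l.
  by rewrite !inE => /andP[].
have GE : (q <= #|L| + 3)%N.
  rewrite -cardsT -(setUCr L) (leq_trans (leq_card_setU _ _)) // leq_add2l.
  apply: leq_trans (@card_horner_rec F F id [:: 0; -1; 0; 1] 3 _ _ _); rewrite ?oner_neq0 //.
  apply: subset_leq_card; apply/subsetP => l; rewrite !inE negb_and !negbK /=.
  by case/orP=> /eqP l0; apply/eqP; [rewrite l0; ring | transitivity (l * (l ^+ 2 - 1)); [ring | rewrite l0 subrr mulr0]].
split.
  apply: leq_trans GE _; rewrite leq_add2r.
  apply: (@card_le_fibre _ _ L split_tr (fun l => l + l^-1)) => [l Ll|t _]; first exact: imset_f.
  apply: leq_trans (@card_horner_rec F F id [:: 1; -t; 1] 2 _ _ _); rewrite ?oner_neq0 //.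
  apply: subset_leq_card; apply/subsetP => l; rewrite !inE /= => /andP[/andP[l0 _] /eqP <-].
  by apply/eqP; field.
apply: leq_trans LE; rewrite mulnC -sum_nat_const -sum1_card.
rewrite [leqRHS](partition_big (fun l : F => l + l^-1) (mem split_tr)) => [|l Ll]; last first.
  exact: (imset_f (fun l : F => l + l^-1) Ll).
apply: leq_sum => t /imsetP[l Ll ->]; rewrite sum1dep_card.
have nl : l != l^-1.
  move: Ll; rewrite inE => /andP[l0]; apply: contraNneq => ll.
  by apply/eqP; rewrite expr2 -[X in _ * X]invrK -ll mulfV.
have -> : 2%N = #|[set l; l^-1]| by rewrite cards2 nl.
apply: subset_leq_card; apply/subsetP => k; rewrite !inE.
move: Ll; rewrite inE => /andP[l0 l2].
case/orP=> /eqP ->; first by rewrite l0 l2 eqxx.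
by rewrite invr_eq0 l0 exprVn invr_eq1 l2 invrK addrC eqxx.
Qed.

Lemma card_split_el :
  (#|split_tr| * q * q.-1 <= #|split_el| /\ #|split_el| <= #|split_tr| * q * q.+1)%N.
Proof. exact: card_trace_in. Qed.

(** Conjugation by P permutes SL2 whatever the determinant of P. *)
Lemma card_cj (P : 'M[F]_2) (Q : pred 'M[F]_2) : P \in unitmx ->
  #|[set y in SL2 F | Q (cj idfun P y)]| = #|[set y in SL2 F | Q (GLval y)]|.
Proof.
move=> uP; pose u : {'GL_2[F]} := Sub P uP.
have cjE y : cj idfun P y = GLval (u * y * u^-1)%g by rewrite /cj map_mx_id.
have inj_f : injective (fun y => u * y * u^-1)%g by move=> y z /mulIg /mulgI.
rewrite -[RHS](card_preimset _ inj_f); apply: eq_card => y; rewrite !inE cjE.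
by congr (_ && _); rewrite !GLvalM !det_mulmx mulrAC -det_mulmx -GLvalM mulgV det1 mul1r.
Qed.

(** With x = diag(m, m^-1) and y of diagonal (a, d), the two traces are a + d and m a + m^-1 d.
    These linear forms are independent as m^2 is not 1, so |T|^2 diagonals qualify, T being
    [split_tr]. The error term comes from the q - 1 diagonals with ad = 1. *)
Lemma card_split_pairs x : x \in split_el ->
  let N := #|[set y in SL2 F | (tr y \in split_tr) && (tr (x * y)%g \in split_tr)]| in
  (#|split_tr| ^ 2 * q.-1 <= N /\ N <= #|split_tr| ^ 2 * q.-1 + q.-1 * q)%N.
Proof.
rewrite inE => /andP[Gx /imsetP[l]]; rewrite inE => /andP[l0 l2] txl N.
have [P [m [uP m0 m2 cx]]] : exists P m,
    [/\ P \in unitmx, m != 0, m ^+ 2 != 1 & cj idfun P x = mx2 m 0 0 m^-1].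
  have dx : \det (GLval x) = 1 by move: Gx; rewrite in_SL2 => /eqP.
  have [P [m [uP m0 m2 cx]]] := diagonalize2 dx l0 (esym txl) l2.
  by exists P, m; rewrite /cj map_mx_id.
pose Q (s : F * F) := (s.1 + s.2 \in split_tr) && (m * s.1 + m^-1 * s.2 \in split_tr).
have -> : N = #|[set y in SL2 F | Q (GLval y 0 0, GLval y 1 1)]|.
  rewrite -(card_cj (fun A => Q (A 0 0, A 1 1)) uP); apply: eq_card => y; rewrite !inE /Q /=.
  congr (_ && (_ && _)); first by rewrite -tr2E cj_tr.
  by rewrite /tr -[\tr _](cj_tr idfun uP) cjM // cx tr2E !mul2E !mxE /= !mul0r addr0 add0r.
rewrite card_SL2_diag card_pairs_in; last first.
  move=> [a d] [a' d'] /= [e1 e2].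
  have ea : a = a'.
    apply: (@mulfI _ (m ^+ 2 - 1)); first by rewrite subr_eq0.
    transitivity (m * (m * a + m^-1 * d) - (a + d)); first by field.
    by rewrite e1 e2; field.
  by move: e1; rewrite ea => /addrI ->.
rewrite mulnn; split; first exact: leq_addr.
rewrite leq_add2l leq_mul2r; apply/orP; right.
rewrite -card_unit_pairs; apply: subset_leq_card.
by apply/subsetP => s; rewrite !inE => /andP[].
Qed.

End Splitting.

(** * About 1/8 of all pairs are split, about 1/8 are nonsplit, and most of these generate *)

Section PairCounts.
Variable F : finFieldType.
Local Notation q := #|F|.
Local Notation g := #|SL2 F|.
Implicit Types (x y : {'GL_2[F]}) (A : {set {'GL_2[F]}}).

Definition closed_pairs A :=
  [set s : {'GL_2[F]} * {'GL_2[F]} | [&& s.1 \in A, s.2 \in A & (s.1 * s.2)%g \in A]].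
Definition generating_pairs :=
  [set s : {'GL_2[F]} * {'GL_2[F]} | <<[set s.1; s.2]>>%g == SL2 F].

Lemma split_el_sub : split_el F \subset SL2 F.
Proof. by apply/subsetP => x; rewrite inE => /andP[]. Qed.

Lemma nonsplit_el_sub : nonsplit_el F \subset SL2 F.
Proof. by apply/subsetP => x; rewrite inE => /andP[]. Qed.

Lemma card_closed_split :
  let N := #|closed_pairs (split_el F)| in let T := #|split_tr F| in
  (#|split_el F| * (T ^ 2 * q.-1) <= N /\ N <= #|split_el F| * (T ^ 2 * q.-1 + q.-1 * q))%N.
Proof.
move=> N T; have -> : (N = \sum_(x in split_el F)
    #|[set y in SL2 F | (tr y \in split_tr F) && (tr (x * y)%g \in split_tr F)]|)%N.
  rewrite /N /closed_pairs card_sum_pair /= [RHS]big_mkcond; apply: eq_bigr => x _.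
  case: ifP => Sx; last by rewrite eq_card0 // => y; rewrite !inE.
  move: Sx; rewrite inE in_SL2 => /andP[/eqP dx tx].
  apply: eq_card => y; rewrite !inE /= det_mulmx dx mul1r -/(GLval y).
  by case: eqP.
rewrite -!sum_nat_const; split; apply: leq_sum => x Sx; first exact: (card_split_pairs Sx).1.
exact: (card_split_pairs Sx).2.
Qed.

(** Inclusion-exclusion for the complement A of the nonsplit elements. A pair closed in A is closed
    in the split elements, or one of x, y, xy has trace 2 or -2; the latter accounts for at most 6 q
    (q + 1) g pairs. *)
Lemma card_closed_nonsplit :
  (2 * g ^ 2 <= 8 * #|closed_pairs (nonsplit_el F)| + 8 * #|closed_pairs (split_el F)|
     + 48 * q * q.+1 * g)%N.
Proof.
pose A := [set x in SL2 F | tr x \in split_tr F :|: irr_tr F].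
pose I := [set x in SL2 F | tr x \in irr_tr F].
have sAG : A \subset SL2_group F by apply/subsetP => x; rewrite inE => /andP[].
have leI : (#|I| <= 2 * q * q.+1)%N.
  by apply: leq_trans (card_trace_in _).2 _; rewrite !leq_mul2r card_irregular !orbT.
have sumE (P : rel {'GL_2[F]}) : (forall x y, P x y -> (x \in SL2 F) && (y \in SL2 F)) ->
   (\sum_(x in SL2_group F) \sum_(y in SL2_group F) P x y = #|[set s | P s.1 s.2]|)%N.
  move=> PG; rewrite card_sum_pair big_mkcond; apply: eq_bigr => x _ /=.
  case: ifP => Gx; last by rewrite eq_card0 // => y; rewrite inE; apply/negP => /PG; rewrite Gx.
  rewrite -sum1dep_card big_mkcond [RHS]big_mkcond; apply: eq_bigr => y _ /=.
  by case: ifP => Gy; case: ifP => // /PG; rewrite Gx /= Gy.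
have NE x : x \in SL2_group F -> (x \notin A) = (x \in nonsplit_el F).
  by move=> Gx; rewrite !inE -in_SL2 Gx.
pose nsp x y := [&& x \in nonsplit_el F, y \in nonsplit_el F & (x * y)%g \in nonsplit_el F].
pose asp x y := [&& x \in A, y \in A & (x * y)%g \in A].
have NN : (#|closed_pairs (nonsplit_el F)| + #|closed_pairs A| + 3 * (g * #|A|)
    = g ^ 2 + 3 * #|A| ^ 2)%N.
  rewrite -(sum_indicator_pairs sAG) -[#|closed_pairs (nonsplit_el F)|]/#|[set s | nsp s.1 s.2]|.
  rewrite -[#|closed_pairs A|]/#|[set s | asp s.1 s.2]| -!sumE.
  - congr (_ + _ + _)%N; apply: eq_bigr => x Gx; apply: eq_bigr => y Gy.
    by rewrite !NE ?groupM.
  - by move=> x y /and3P[/(subsetP sAG) -> /(subsetP sAG) ->].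
  - by move=> x y /and3P[/(subsetP nonsplit_el_sub) -> /(subsetP nonsplit_el_sub) ->].
have leA : (#|closed_pairs A| <= #|closed_pairs (split_el F)| + 6 * q * q.+1 * g)%N.
  pose P1 x y := (x \in I) && (y \in SL2 F).
  pose P2 x y := (x \in SL2 F) && (y \in I).
  pose P3 x y := [&& x \in SL2 F, y \in SL2 F & (x * y)%g \in I].
  have sIG : I \subset SL2_group F by apply/subsetP => x; rewrite inE => /andP[].
  have c1 : (#|[set s | P1 s.1 s.2]| = g * #|I|)%N.
    by rewrite mulnC -cardsX; apply: eq_card => s; rewrite !inE.
  have c2 : (#|[set s | P2 s.1 s.2]| = g * #|I|)%N.
    by rewrite -cardsX; apply: eq_card => s; rewrite !inE.
  have c3 : (#|[set s | P3 s.1 s.2]| = g * #|I|)%N.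
    rewrite -sumE; last by move=> x y /and3P[-> ->].
    rewrite -sum_nat_const; apply: eq_bigr => x Gx; rewrite -(sum_mem_mulr sIG Gx).
    by apply: eq_bigr => y Gy; rewrite /P3 Gx Gy.
  apply: (@leq_trans (#|closed_pairs (split_el F)| + (g * #|I| + g * #|I| + g * #|I|))); last first.
    rewrite leq_add2l -{1}[(g * #|I|)%N]mul1n -mulSnr -mulSnr mulnCA mulnC leq_mul2r.
    by have := leq_mul (leqnn 3) leI; rewrite !mulnA => ->; rewrite orbT.
  rewrite -{1}c1 -{1}c2 -c3.
  apply: leq_trans (leq_add (leqnn _) (leq_add (leq_card_setU _ _) (leqnn _))).
  apply: leq_trans (leq_add (leqnn _) (leq_card_setU _ _)).
  apply: leq_trans (leq_card_setU _ _); apply: subset_leq_card; apply/subsetP => -[x y].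
  have AE z : z \in A -> (z \in SL2 F) && ((z \in split_el F) || (z \in I)).
    by rewrite !inE => /andP[-> ].
  have memP (P : rel {'GL_2[F]}) : ((x, y) \in [set s | P s.1 s.2]) = P x y by rewrite inE.
  have e0 : ((x, y) \in closed_pairs (split_el F)) =
    [&& x \in split_el F, y \in split_el F & (x * y)%g \in split_el F] by rewrite inE.
  rewrite inE !in_setU !memP e0 /P1 /P2 /P3 /= => /and3P[/AE /andP[Gx Sx] /AE /andP[Gy Sy] /AE /andP[_ Sxy]].
  rewrite Gx Gy /=; case/orP: Sx => [Sx | ->]; last by rewrite !orbT.
  case/orP: Sy => [Sy | ->]; last by rewrite !orbT.
  by case/orP: Sxy => [Sxy | ->]; [rewrite Sx Sy Sxy | rewrite !orbT].
move: NN leA; rewrite -!mulnA; move: (q * _)%N #|closed_pairs _| #|closed_pairs _| => k n a.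
move: #|A| #|closed_pairs _| g => b s G e le.
(* 4bG <= 4b^2 + G^2 yields G^2 - 3bG + 3b^2 >= G^2 / 4. *)
have [le_bG _] := nat_Cauchy (2 * b) G; rewrite -!mulnn in le_bG e *; nia.
Qed.

Lemma real_counts (R : realFieldType) : let Q := q%:R : R in let T := #|split_tr F|%:R : R in
  [/\ 2 <= Q, g%:R = Q ^+ 3 - Q, Q <= 2 * T + 3, 2 * T <= Q - 1 & 0 <= T].
Proof.
move=> Q T; have q1 := card_F_gt1 F; have [Tge Tle] := card_split_tr F.
split=> //; first by rewrite /Q ler_nat.
- rewrite card_SL2 natrB ?natrX // -{1}[q]expn1 leq_exp2l //.
- by rewrite -natrM -natrD ler_nat.
by rewrite lerBrDr -natrM natr1 ler_nat -(prednK (ltnW q1)) ltnS.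
Qed.

Lemma card_closed_split_ge : (q * g ^ 2 <= 8 * q * #|closed_pairs (split_el F)| + 11 * g ^ 2)%N.
Proof.
have [leS _] := card_closed_split; have [leE _] := card_split_el F.
have [Q2 gE QT TQ T0] := real_counts rat; have q1 := card_F_gt1 F.
rewrite -(ler_nat rat) !(natrD, natrM, natrX) gE.
have : #|split_tr F|%:R ^+ 3 * q%:R * (q%:R - 1) ^+ 2 <= #|closed_pairs (split_el F)|%:R :> rat.
  have -> : q%:R - 1 = (q.-1)%:R :> rat by rewrite -{1}(prednK (ltnW q1)) -natr1 addrK.
  rewrite -!natrX -!natrM ler_nat; apply: leq_trans leS.
  apply: leq_trans (leq_mul leE (leqnn _)); rewrite leq_eqVlt; apply/orP; left; apply/eqP.
  by rewrite !expnS !expn0; ring.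
move: #|closed_pairs _|%:R q%:R #|split_tr F|%:R Q2 QT TQ T0 => N Q T Q2 QT TQ T0 leN.
(* Since 2T >= Q - 3, this is compared with (Q - 3)^3; the constant 11 = 9 + 2 makes the quadratic
   terms agree. *)
suff : (Q - 11%:R) * (Q + 1) ^+ 2 <= 8%:R * T ^+ 3.
  move=> le1; have h : 0 <= (Q * (Q - 1)) ^+ 2 by apply: sqr_ge0.
  have := ler_wpM2l h le1; have : 8%:R * Q * (T ^+ 3 * Q * (Q - 1) ^+ 2) <= 8%:R * Q * N.
    by rewrite ler_wpM2l //; lra.
  by lra.
have [Q3 | Q3] := lerP Q 3.
  have T3 : 0 <= T ^+ 3 by apply: exprn_ge0.
  by have : 0 <= (Q + 1) ^+ 2 by [apply: sqr_ge0]; nra.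
have : (Q - 3) ^+ 3 <= (2 * T) ^+ 3 by apply: lerXn2r; rewrite ?nnegrE; lra.
have -> : (2 * T) ^+ 3 = 8%:R * T ^+ 3 by ring.
by apply: le_trans; nra.
Qed.

(** The inclusion-exclusion bound has main term 2 g^2, of which the split pairs take at most g^2 (1
    + 1/q). The constant is 97 = 1 + 96, with 96 from the elements of trace 2 or -2. *)
Lemma card_closed_nonsplit_ge :
  (q * g ^ 2 <= 8 * q * #|closed_pairs (nonsplit_el F)| + 97 * g ^ 2)%N.
Proof.
have [_ leS0] := card_closed_split; have [_ leE] := card_split_el F.
have := card_closed_nonsplit.
have [Q2 gE QT TQ T0] := real_counts rat; have q1 := card_F_gt1 F.
rewrite -!(ler_nat rat) !(natrD, natrM, natrX) gE.
have : #|closed_pairs (split_el F)|%:R <=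
    #|split_tr F|%:R * (#|split_tr F|%:R ^+ 2 + q%:R) * (q%:R ^+ 3 - q%:R) :> rat.
  rewrite -gE -!natrX -!natrD -!natrM ler_nat; apply: leq_trans leS0 _.
  apply: leq_trans (leq_mul leE (leqnn _)) _; rewrite leq_eqVlt; apply/orP; left; apply/eqP.
  rewrite card_SL2; move: q1 #|split_tr F|; case: q => // n _ T.
  have -> : (n.+1 ^ 3 - n.+1 = n.+1 * n * n.+2)%N by rewrite !expnS expn0; lia.
  by rewrite !expnS !expn0 /=; ring.
rewrite -[q.+1]addn1 natrD.
move: #|closed_pairs _|%:R #|closed_pairs _|%:R q%:R #|split_tr F|%:R Q2 QT TQ T0 {leS0 leE} => N S Q T Q2 QT TQ T0 leS leN.
have T2 : 8%:R * (T * (T ^+ 2 + Q)) <= (Q - 1) * (Q + 1) ^+ 2.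
  have T4 : 4%:R * T ^+ 2 <= (Q - 1) ^+ 2.
    have -> : 4%:R * T ^+ 2 = (2 * T) ^+ 2 by ring.
    by apply: lerXn2r; rewrite ?nnegrE; lra.
  have := ler_wpM2l T0 T4; have : 0 <= Q - 1 - 2 * T by lra.
  have : 0 <= (Q + 1) ^+ 2 by apply: sqr_ge0.
  by nra.
pose G := Q ^+ 3 - Q; rewrite -/G in leS leN *.
have GE : G = Q * (Q - 1) * (Q + 1) by rewrite /G; ring.
have G0 : 0 <= G by rewrite GE !mulr_ge0 //; lra.
have h1 : 8%:R * S <= G * ((Q - 1) * (Q + 1) ^+ 2).
  apply: le_trans (_ : G * (8%:R * (T * (T ^+ 2 + Q))) <= _); last exact: ler_wpM2l.
  by lra.
have h2 : 48%:R * Q ^+ 2 * (Q + 1) <= 96%:R * G.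
  rewrite GE; have : 0 <= Q * (Q + 1) * (Q - 2) by rewrite !mulr_ge0 //; lra.
  by lra.
have h3 := ler_wpM2l G0 h2.
have Q0 : 0 <= Q by lra.
have := ler_wpM2l Q0 leN; have := ler_wpM2l Q0 h1.
have -> : Q * (G * ((Q - 1) * (Q + 1) ^+ 2)) = G * (G * (Q + 1)) by rewrite GE; ring.
by lra.
Qed.

(** The nongenerating pairs are simply discarded; relative to g^2 they are O((1 + D M) / q), with D
    the number of divisors of g. *)
Lemma card_good_pairs_ge A M C : A \subset SL2 F -> (4 ^ 6 * q ^ 5 < M ^ 6)%N ->
    (q * g ^ 2 <= 8 * q * #|closed_pairs A| + C * g ^ 2)%N ->
  (q * g ^ 2 <= 8 * q * #|closed_pairs A :&: generating_pairs|
     + (C + 96 + 16 * (size (divisors g) * M)) * g ^ 2)%N.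
Proof.
move=> sAG ltM leC; have := card_nongenerating ltM.
set Z := [set s | _] => leZ.
have leA : (#|closed_pairs A| <= #|closed_pairs A :&: generating_pairs| + #|Z|)%N.
  rewrite -(cardsID generating_pairs) leq_add2l; apply: subset_leq_card.
  apply/subsetP => s; rewrite !inE => /andP[-> /and3P[A1 A2 _]].
  by rewrite -!in_SL2 (subsetP sAG _ A1) (subsetP sAG _ A2).
suff : (8 * q * #|Z| <= (96 + 16 * (size (divisors g) * M)) * g ^ 2)%N.
  move=> leZ'; apply: leq_trans leC _.
  rewrite -[(C + 96 + _)%N]addnA mulnDl addnCA addnC leq_add2l.
  apply: leq_trans (leq_add (leqnn _) leZ'); rewrite -mulnDr leq_mul2l leA orbT //.
have [Q2 gE _ _ _] := real_counts rat.
apply: leq_trans (leq_mul (leqnn (8 * q)) leZ) _.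
move: (size _ * M)%N => k; rewrite -!(ler_nat rat) !(natrD, natrM, natrX) gE.
rewrite -[q.+1]addn1 natrD; have : 0 <= k%:R :> rat by apply: ler0n.
move: k%:R q%:R Q2 => K Q Q2 K0.
have -> : (Q ^+ 3 - Q) = Q * (Q - 1) * (Q + 1) by ring.
have h : 0 <= Q * (Q - 1) * (Q + 1) * Q by rewrite !mulr_ge0 //; lra.
have h1 : 0 <= (2 + K) * (Q + 1) * (Q - 2) by rewrite !mulr_ge0 //; lra.
have h2 : 0 <= (Q - 2) * (Q + 2) by rewrite mulr_ge0 //; lra.
have := mulr_ge0 h h1; have := mulr_ge0 h h2; by lra.
Qed.

End PairCounts.

(** * Passing to a quotient group *)

Section Quotient.
Variables (gT : finGroupType) (G H : {group gT}).
Hypothesis nsHG : (H <| G)%g.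

Lemma sum_quotient (f : coset_of H -> nat) :
  (\sum_(x in G) f (coset H x) = #|H| * \sum_(X in (G / H)%g) f X)%N.
Proof.
have nHG := normal_norm nsHG; have sHG := normal_sub nsHG.
rewrite (partition_big (coset H) (mem (G / H)%g)) /=; last by move=> x Gx; apply: mem_quotient.
rewrite big_distrr; apply: eq_bigr => X /morphimP[y Ny Gy ->].
rewrite (eq_bigr (fun=> f (coset H y))); last by move=> x /andP[_ /eqP ->].
rewrite sum_nat_cond_const; congr (_ * _)%N; rewrite -(card_rcoset H y); apply: eq_card => x.
rewrite !inE; apply/andP/idP => [[Gx /eqP exy]|Hxy].
  by apply/rcoset_kercosetP; rewrite // (subsetP nHG).
have Gx : x \in G.
  by have [h Hh ->] := rcosetP Hxy; rewrite groupM // (subsetP sHG).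
by split=> //; apply/eqP/rcoset_kercosetP; rewrite // (subsetP nHG).
Qed.

Lemma quotient_generate x y : x \in G -> y \in G -> <<[set x; y]>>%g = G ->
  <<[set coset H x; coset H y]>>%g = (G / H)%g.
Proof.
move=> Gx Gy defG; have nHG := normal_norm nsHG.
have sN : [set x; y] \subset 'N(H)%g by rewrite subUset !sub1set !(subsetP nHG).
rewrite -[in RHS]defG quotient_gen // quotientE morphimEsub // imsetU1 imset_set1.
by [].
Qed.

End Quotient.

(** * Criteria for and against being a Beauville structure *)

Section Beauville.
Variables (gT : finGroupType) (G : {group gT}).
Implicit Types x y z u v w : gT.

Lemma beauville_SigmaP x y z w :
  reflect (exists v n, [/\ v \in G, w = ((x ^+ n) ^ v)%g \/ w = ((y ^+ n) ^ v)%g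
                           \/ w = ((z ^+ n) ^ v)%g & True])
          (w \in beauville_Sigma G x y z).
Proof.
apply: (iffP bigcupP) => [[u]|[v [n [Gv wE _]]]].
  rewrite !inE -orbA => /or3P[] /cycleP[n ->] /imsetP[v Gv ->]; exists v, n; split=> //; auto.
by case: wE => [|[]] ->; [exists (x ^+ n)%g | exists (y ^+ n)%g | exists (z ^+ n)%g];
  rewrite ?mem_class ?inE ?mem_cycle ?orbT ?memJ_class.
Qed.

Lemma beauville_Sigma1 x y z : 1%g \in beauville_Sigma G x y z.
Proof. by apply/beauville_SigmaP; exists 1%g, 0; split=> //; left; rewrite expg0 conj1g. Qed.

Lemma beauville_Sigma_expg x y z w a : (x ^+ a = 1)%g -> (y ^+ a = 1)%g -> (z ^+ a = 1)%g ->
  w \in beauville_Sigma G x y z -> (w ^+ a = 1)%g.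
Proof.
move=> xa ya za /beauville_SigmaP[v [n [_ wE _]]].
by case: wE => [|[]] ->; rewrite -conjXg expgAC ?xa ?ya ?za expg1n conj1g.
Qed.

(** Elements of the first Sigma set have order dividing a and those of the second order dividing b,
    so a common element is trivial. *)
Lemma unmixed_beauville_coprime x1 y1 x2 y2 a b :
    [/\ x1 \in G, y1 \in G, x2 \in G & y2 \in G] ->
    <<[set x1; y1]>>%g = G -> <<[set x2; y2]>>%g = G ->
    [/\ x1 ^+ a = 1, y1 ^+ a = 1 & (x1 * y1) ^+ a = 1]%g ->
    [/\ x2 ^+ b = 1, y2 ^+ b = 1 & (x2 * y2) ^+ b = 1]%g ->
  coprime a b -> unmixed_beauville G x1 y1 x2 y2.
Proof.
move=> [Gx1 Gy1 Gx2 Gy2] gen1 gen2 [xa ya za] [xb yb zb] cop_ab.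
rewrite /unmixed_beauville Gx1 Gy1 Gx2 Gy2 gen1 gen2 !eqxx /=.
rewrite eqEsubset; apply/andP; split; last by rewrite sub1set inE !beauville_Sigma1.
apply/subsetP => w; rewrite !inE => /andP[wa wb]; rewrite -order_eq1 -dvdn1 -(eqP cop_ab).
rewrite dvdn_gcd !order_dvdn; apply/andP; split; apply/eqP.
  by apply: beauville_Sigma_expg wa; rewrite // expgVn za invg1.
by apply: beauville_Sigma_expg wb; rewrite // expgVn zb invg1.
Qed.

Lemma not_unmixed_beauville x1 y1 x2 y2 v i j : v \in G ->
  (x1 ^+ i != 1)%g -> (x2 ^+ j = (x1 ^+ i) ^ v)%g -> unmixed_beauville G x1 y1 x2 y2 = false.
Proof.
move=> Gv n1 e; apply/negP => /and4P[_ _ _ /eqP/setP/(_ ((x1 ^+ i) ^ v)%g)].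
rewrite !inE -(conj1g v) (inj_eq (conjg_inj v)) (negPf n1) => /negP[]; apply/andP; split.
  by apply/beauville_SigmaP; exists v, i; split=> //; left.
by apply/beauville_SigmaP; exists 1%g, j; split=> //; left; rewrite e conjg1.
Qed.

End Beauville.

(** * Orders of split and nonsplit elements in PSL2(q) *)

Section TorusOrders.
Variable F : finFieldType.
Local Notation q := #|F|.
Local Notation Z := 'Z(SL2_group F)%g.
Implicit Types (x y : {'GL_2[F]}).

Lemma nsZSL2 : (Z <| SL2_group F)%g. Proof. exact: center_normal. Qed.

Lemma cj_scalar_center (K : fieldType) (phi : {rmorphism F -> K}) P x c :
  P \in unitmx -> x \in SL2 F -> cj phi P x = c%:M -> x \in Z.
Proof.
move=> uP Gx cx; apply/centerP; split=> // y _; apply: (@cj_inj F K phi P uP).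
by rewrite !cjM // cx scalar_mxC.
Qed.

(** m^(2a) = 1 means m^a = m^-a, so x^a is scalar and hence central. *)
Lemma coset_expg_torus (K : fieldType) (phi : {rmorphism F -> K}) P x m a :
    P \in unitmx -> x \in SL2 F -> m != 0 -> cj phi P x = mx2 m 0 0 m^-1 ->
  m ^+ (2 * a) = 1 -> (coset Z x ^+ a = 1)%g.
Proof.
move=> uP Gx m0 cx ma; have nx : x \in 'N(Z)%g by rewrite (subsetP (normal_norm nsZSL2)).
rewrite -morphX //; apply: coset_id.
apply: (@cj_scalar_center K phi P _ (m ^+ a)) => //; first exact: (@groupX _ (SL2_group F)).
rewrite (cj_expg uP cx) scalar_mx2; congr mx2.
have ma0 : m ^+ a != 0 by rewrite expf_neq0.
by apply: (mulfI ma0); rewrite mulfV // -exprD addnn -mul2n ma.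
Qed.

Lemma split_expg x : x \in split_el F -> (coset Z x ^+ (q.-1 %/ gcdn 2 q.-1) = 1)%g.
Proof.
rewrite inE => /andP[Gx /imsetP[l]]; rewrite inE => /andP[l0 l2] txl.
have dx : \det (GLval x) = 1 by move: Gx; rewrite in_SL2 => /eqP.
have [P [m [uP m0 m2 cx]]] := diagonalize2 dx l0 (esym txl) l2.
apply: (@coset_expg_torus _ idfun P _ m) => //; first by rewrite /cj map_mx_id.
have mq : m ^+ q.-1 = 1.
  by apply: (mulfI m0); rewrite -exprS prednK ?expf_card ?mulr1 // ltnW // card_F_gt1.
by rewrite muln_divA ?dvdn_gcdr // -divn_mulAC ?dvdn_gcdl // mulnC exprM mq expr1n.
Qed.

(** Frobenius fixes the trace m + m^-1, so m^q is m or m^-1. The first would put m in F and make the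
    trace split; hence m^(q+1) = 1. *)
Lemma nonsplit_expg x : [pchar F].-nat q -> x \in nonsplit_el F ->
  (coset Z x ^+ (q.+1 %/ gcdn 2 q.-1) = 1)%g.
Proof.
move=> pq; rewrite inE => /andP[Gx]; rewrite !inE negb_or => /andP[txs txi].
have [K [phi _]] := countable_algebraic_closure F.
have [P [m [uP m0 m2 cx]]] := regular_diag phi Gx txi.
apply: (coset_expg_torus uP Gx m0 cx).
have tm : m + m^-1 = phi (tr x) by rewrite -[RHS](cj_tr phi uP) cx tr_mx2.
have eq2 : gcdn 2 q.-1 = gcdn 2 q.+1.
  have -> : q.+1 = (q.-1 + 2)%N by rewrite addn2 (prednK (ltnW (card_F_gt1 F))).
  by rewrite gcdnDr.
suff mq : m ^+ q.+1 = 1.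
  by rewrite eq2 muln_divA ?dvdn_gcdr // -divn_mulAC ?dvdn_gcdl // mulnC exprM mq expr1n.
have pqK : [pchar K].-nat q.
  by apply: sub_in_pnat pq => p _; apply: rmorph_pchar.
have mqE : m ^+ q + (m ^+ q)^-1 = m + m^-1.
  by rewrite -exprVn -exprDn_pchar // tm -rmorphXn expf_card.
have [mq | mq] := add_inv_inj (expf_neq0 q m0) m0 mqE; last by rewrite exprS mq mulfV.
case/negP: txs; suff [l ml] : exists l, m = phi l.
  apply/imsetP; exists l; last by apply: (fmorph_inj phi); rewrite rmorphD fmorphV -ml.
  by rewrite inE -(fmorph_eq0 phi) -(inj_eq (fmorph_inj phi)) rmorphXn rmorph1 -ml m0.
have [|/existsPn mF] := boolP [exists l, m == phi l]; first by case/existsP => l /eqP; exists l.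
(* If m were outside the image of F, then X^q - X would have q + 1 roots. *)
have p0 : 'X^q - 'X != 0 :> {poly K}.
  rewrite -size_poly_gt0 size_polyDl ?size_polyXn // size_polyN size_polyX ltnS.
  exact: card_F_gt1.
have := @max_poly_roots _ ('X^q - 'X) (m :: map phi (enum F)) p0.
rewrite /= size_map -cardE size_polyDl ?size_polyXn ?ltnn; last first.
  by rewrite size_polyN size_polyX ltnS card_F_gt1.
rewrite (map_inj_uniq (fmorph_inj phi)) enum_uniq andbT /root !hornerE mq subrr eqxx /=.
have -> : all (root ('X^q - 'X)) [seq phi i | i <- enum F].
  by apply/allP => y /mapP[l _ ->]; rewrite /root !hornerE -rmorphXn expf_card subrr.
have -> : m \notin [seq phi i | i <- enum F].
  by apply/negP => /mapP[l _ ml]; move: (mF l); rewrite ml eqxx.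
by move=> /(_ isT isT).
Qed.

(** gcd(q - 1, q + 1) = gcd(2, q - 1), which is the divisor taken out of both. *)
Lemma coprime_torus : coprime (q.-1 %/ gcdn 2 q.-1) (q.+1 %/ gcdn 2 q.-1).
Proof.
have q1 := card_F_gt1 F.
have e : q.+1 = (q.-1 + 2)%N by rewrite addn2 (prednK (ltnW q1)).
rewrite e /coprime; set d := gcdn 2 _; have d0 : (0 < d)%N by rewrite gcdn_gt0.
rewrite -(eqn_pmul2r d0) muln_gcdl !divnK ?dvdn_addr ?dvdn_gcdr ?dvdn_gcdl //.
by rewrite gcdnDl gcdnC mul1n.
Qed.

End TorusOrders.

(** If p does not divide the order of x, then p-th powering is bijective on <x>; otherwise
    x^(#[x]/p) has order p. So an element that is visibly not a p-th power has a power of order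
    p. *)
Lemma root_or_torsion (gT : finGroupType) (x : gT) p : prime p ->
  (exists n, ((x ^+ n) ^+ p = x)%g) \/
  (exists n, ((x ^+ n) ^+ p = 1)%g /\ (x ^+ n != 1)%g).
Proof.
move=> pr_p; have [/dvdnP[k nk]|ndvd] := boolP (p %| #[x]%g)%N; [right | left].
  have k0 : (0 < k)%N by have := order_gt0 x; rewrite nk muln_gt0 => /andP[].
  exists k; rewrite -expgM -nk expg_order -order_dvdn nk; split=> //.
  by apply/negP => /(dvdn_leq k0); rewrite leqNgt ltn_Pmulr ?prime_gt1.
have cop : coprime #[x]%g p by rewrite coprime_sym prime_coprime.
by exists (expg_invn <[x]>%g p); rewrite expgAC (expgK cop) ?cycle_id.
Qed.

(** * Traces of powers, companion matrices, and 3-torsion in characteristic 2 *)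

Section SharedTorsion.
Variable F : finFieldType.
Local Notation q := #|F|.
Local Notation Z := 'Z(SL2_group F)%g.
Implicit Types (x y u v : {'GL_2[F]}) (t : F).

Lemma center_scalar x : x \in Z -> exists2 e, e ^+ 2 = 1 & GLval x = e%:M.
Proof.
move=> /centerP[Gx Cx]; have dx := SL2_det Gx.
have := Cx _ (sl2_in (det_uni 1)); have := Cx _ (sl2_in (det_low 1)).
move=> /(congr1 (@GLval 2 F)) + /(congr1 (@GLval 2 F)).
rewrite !GLvalM !sl2_val ?det_uni ?det_low // [GLval x]mx2_eta !mul_mx2.
move: dx; move: (GLval x 0 0) (GLval x 0 1) (GLval x 1 0) (GLval x 1 1) => a b c d dx.
move=> /matrixP e1 /matrixP e2.
move: (e1 0 0) (e1 1 0) (e2 0 0) => {e1 e2}; rewrite !mxE /= !(mulr1, mulr0, mul1r, mul0r, addr0, add0r).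
move=> b0 cd c0.
have b00 : b = 0 by apply: (addrI a); rewrite b0 addr0.
have c00 : c = 0 by apply: (addrI a); rewrite -c0 addr0.
have ad : a = d by move: cd; rewrite c00 add0r addr0.
exists a; last by rewrite scalar_mx2 b00 c00 ad.
by rewrite -dx b00 c00 -ad mul0r subr0.
Qed.

Lemma scalar_center x e : x \in SL2 F -> GLval x = e%:M -> x \in Z.
Proof.
move=> Gx xe; apply/centerP; split=> // y _; apply: GLval_inj.
by rewrite !GLvalM xe scalar_mxC.
Qed.

Lemma SL2X x n : x \in SL2 F -> (x ^+ n)%g \in SL2 F.
Proof.
rewrite !in_SL2 => /eqP dx; elim: n => [|n /eqP IHn]; first by rewrite det1.
by rewrite expgS GLvalM det_mulmx dx IHn mulr1.
Qed.

Lemma SL2_conj_inv w w' : w \in SL2 F -> w' \in SL2 F -> (w * w'^-1)%g \in SL2 F.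
Proof.
rewrite !in_SL2 => /eqP dw /eqP dw'.
by rewrite GLvalM det_mulmx dw mul1r [GLval _]/(invmx (GLval w')) det_inv dw' invr1.
Qed.

Lemma coset_eq1 x : x \in SL2 F -> (coset Z x == 1)%g = (x \in Z).
Proof.
move=> Gx; have nx : x \in 'N(Z)%g by rewrite (subsetP (normal_norm (nsZSL2 F))).
apply/eqP/idP => [|Zx]; last exact: coset_id.
exact: coset_idr.
Qed.

Lemma GLvalX x n : GLval (x ^+ n)%g = GLval x ^+ n.
Proof. by elim: n => // n IHn; rewrite expgS exprS GLvalM IHn. Qed.

Lemma sqr_SL2 x : x \in SL2 F -> GLval (x ^+ 2)%g = tr x *: GLval x - 1%:M.
Proof. by rewrite in_SL2 => /eqP dx; rewrite GLvalX expr2 [LHS]cayley_hamilton2. Qed.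

Lemma tr_sqr x : x \in SL2 F -> tr (x ^+ 2)%g = tr x ^+ 2 - 2%:R.
Proof.
move=> Gx; rewrite /tr sqr_SL2 // /tr linearB /= linearZ /= mxtrace1.
by rewrite expr2.
Qed.

Lemma cube_SL2 x : x \in SL2 F ->
  GLval (x ^+ 3)%g = (tr x ^+ 2 - 1) *: GLval x - (tr x)%:M.
Proof.
move=> Gx; rewrite expgSr GLvalM sqr_SL2 // mulmxBl -scalemxAl mul1mx.
have -> : GLval x *m GLval x = tr x *: GLval x - 1%:M by rewrite -sqr_SL2 // GLvalX expr2.
rewrite scalerBr scalerA -expr2 scalerBl scale1r.
by rewrite -[(tr x)%:M]scalemx1 addrAC.
Qed.

Lemma tr_cube x : x \in SL2 F -> tr (x ^+ 3)%g = tr x ^+ 3 - 3%:R * tr x.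
Proof.
move=> Gx; rewrite {1}/tr cube_SL2 // linearB /= linearZ /= mxtrace_scalar.
by rewrite -/(tr x); ring.
Qed.

Lemma tr_eq_scalar x e : x \in SL2 F -> (tr x) *: GLval x = e%:M -> x \notin Z -> tr x = 0.
Proof.
move=> Gx xe; apply: contraNeq => t0; apply: (@scalar_center _ (e / tr x)) => //.
by rewrite mulrC -scale_scalar_mx -xe scalerA mulVf // scale1r.
Qed.

(* [v] is a cyclic vector of [u]: the columns [v, u v] form an element of SL2
   conjugating [u] to the companion matrix of its characteristic polynomial. *)
Lemma conj_companion u (r s : F) : u \in SL2 F ->
    r * (GLval u 1 0 * r + GLval u 1 1 * s) - s * (GLval u 0 0 * r + GLval u 0 1 * s) = 1 ->
  exists2 w, w \in SL2 F & (u ^ w)%g = sl2 0 (-1) 1 (tr u).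
Proof.
move=> Gu; have := sl2_eta Gu; have := SL2_det Gu; rewrite /tr tr2E {Gu}.
move: (GLval u 0 0) (GLval u 0 1) (GLval u 1 0) (GLval u 1 1) => a b c d du -> rs1.
have dw : r * (c * r + d * s) - (a * r + b * s) * s = 1 by rewrite -rs1; ring.
exists (sl2 r (a * r + b * s) s (c * r + d * s)); first exact: sl2_in.
rewrite conjgE; apply: (mulgI (sl2 r (a * r + b * s) s (c * r + d * s))); rewrite mulKVg.
rewrite !sl2M //; last by ring.
congr sl2; try ring.
  transitivity ((a + d) * (a * r + b * s) - (a * d - b * c) * r); first by ring.
  by rewrite du; ring.
transitivity ((a + d) * (c * r + d * s) - (a * d - b * c) * s); first by ring.
by rewrite du; ring.
Qed.

Lemma conj_same_trace u v : (exists2 w, w \in SL2 F & (u ^ w)%g = sl2 0 (-1) 1 (tr u)) ->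
    (exists2 w, w \in SL2 F & (v ^ w)%g = sl2 0 (-1) 1 (tr v)) -> tr u = tr v ->
  exists2 w, w \in SL2 F & v = (u ^ w)%g.
Proof.
move=> [w Gw uw] [w' Gw' vw] tuv; exists (w * w'^-1)%g.
  exact: SL2_conj_inv.
by rewrite conjgM uw tuv -vw conjgK.
Qed.

Definition squares := [set t : F | [exists s, t == s ^+ 2]].

Lemma squaresP t : reflect (exists s, t = s ^+ 2) (t \in squares).
Proof. by rewrite inE; apply: (iffP existsP) => [[s /eqP]|[s ->]]; exists s. Qed.

Section Even.
Hypothesis char2 : 2%:R = 0 :> F.

Lemma addrr2 t : t + t = 0.
Proof. by rewrite -mulr2n -mulr_natr char2 mulr0. Qed.

Lemma oppr2 t : - t = t.
Proof. by apply/eqP; rewrite eq_sym -addr_eq0 addrr2. Qed.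

Lemma square_even t : exists s, t = s ^+ 2.
Proof.
have inj_sq : injective (fun s : F => s ^+ 2).
  move=> s r /= e; have : (s - r) ^+ 2 == 0.
    apply/eqP; transitivity (s ^+ 2 - r ^+ 2 + 2%:R * (r ^+ 2 - r * s)); first by ring.
    by rewrite e char2 mul0r subrr addr0.
  by rewrite expf_eq0 /= subr_eq0 => /eqP.
by have [h _ hK] := injF_bij inj_sq; exists (h t); rewrite hK.
Qed.

(** For v = (r, s), [N r s] is the determinant of the columns v, u v. It takes a nonzero value when
    u is not scalar, and v is rescaled to make it 1, every element being a square in characteristic
    2. *)
Lemma conj_companion_even u : u \in SL2 F -> u \notin Z ->
  exists2 w, w \in SL2 F & (u ^ w)%g = sl2 0 (-1) 1 (tr u).
Proof.
move=> Gu nZu.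
pose N r s := r * (GLval u 1 0 * r + GLval u 1 1 * s) - s * (GLval u 0 0 * r + GLval u 0 1 * s).
suff [r [s Nrs]] : exists r s, N r s != 0.
  have [k kE] := square_even (N r s)^-1; apply: (@conj_companion _ (k * r) (k * s)) => //.
  transitivity (k ^+ 2 * N r s); first by rewrite /N; ring.
  by rewrite -kE mulVf.
have [c0|] := eqVneq (N 1 0) 0; last by exists 1, 0.
have [b0|] := eqVneq (N 0 1) 0; last by exists 0, 1.
exists 1, 1; apply: contraNneq nZu => d0; apply: (@scalar_center _ (GLval u 0 0)) => //.
have b1 : GLval u 0 1 = 0 by transitivity (- N 0 1); [rewrite /N; ring | rewrite b0 oppr0].
have c1 : GLval u 1 0 = 0 by transitivity (N 1 0); [rewrite /N; ring | rewrite c0].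
have d1 : GLval u 1 1 = GLval u 0 0.
  transitivity (GLval u 0 0 + N 1 1 + GLval u 0 1 - GLval u 1 0); first by rewrite /N; ring.
  by rewrite d0 b1 c1 subr0 !addr0.
by apply: mx2P; rewrite !mxE /= ?mulr1n ?mulr0n.
Qed.

(** A cube has trace t^3 - 3t, so x is not a cube of one of its powers and some power u satisfies
    u^3 = 1, u != 1. The centre being trivial, u is not scalar, and u^3 = (t^2 - 1) u - t for t = tr
    u forces t^2 = 1, that is t = 1. *)
Lemma three_torsion_even x : x \in SL2 F ->
    tr x \notin [set t ^+ 3 - 3%:R * t | t in [set: F]] ->
  exists n, [/\ (x ^+ n)%g \in SL2 F, (x ^+ n)%g \notin Z & tr (x ^+ n)%g = 1].
Proof.
move=> Gx tx; have [[n xn]|[n [xn3 xn1]]] := root_or_torsion x (isT : prime 3).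
  case/imsetP: tx; exists (tr (x ^+ n)%g); rewrite ?inE // -[in LHS]xn.
  exact: tr_cube (SL2X n Gx).
exists n; move: (SL2X n Gx) xn3 xn1; move: (x ^+ n)%g => u Gu u3 u1.
have nZu : u \notin Z.
  apply: contra u1 => /center_scalar[e e2 ue]; apply/eqP/GLval_inj; rewrite ue.
  have /eqP : (e - 1) ^+ 2 = 0.
    transitivity (e ^+ 2 - 1 + 2%:R * (1 - e)); first by ring.
    by rewrite e2 char2 mul0r subrr addr0.
  by rewrite expf_eq0 /= subr_eq0 => /eqP ->.
split=> //; have := cube_SL2 Gu; rewrite u3 => /eqP; rewrite eq_sym subr_eq => /eqP h.
have t2 : tr u ^+ 2 - 1 = 0.
  apply/eqP; apply: contraNT nZu => t20.
  apply: (@scalar_center _ ((tr u ^+ 2 - 1)^-1 * (1 + tr u))) => //.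
  apply: (scalerI t20); rewrite h scale_scalar_mx mulVKf //.
  by apply: mx2P; rewrite !mxE /= ?mulr1n ?mulr0n ?addr0.
have /eqP : (tr u - 1) ^+ 2 = 0.
  transitivity (tr u ^+ 2 - 1 + 2%:R * (1 - tr u)); first by ring.
  by rewrite t2 char2 mul0r addr0.
by rewrite expf_eq0 /= subr_eq0 => /eqP.
Qed.

End Even.
End SharedTorsion.

Lemma coset_eq_mul (gT : finGroupType) (H : {group gT}) (x y : gT) :
  x \in 'N(H)%g -> y \in 'N(H)%g -> coset H x = coset H y ->
  exists2 z, z \in H & x = (z * y)%g.
Proof. by move=> Nx Ny /(rcoset_kercosetP Nx Ny)/rcosetP[z Hz ->]; exists z. Qed.

(** * Involutions of PSL2(q) for odd q *)

Section OddTorsion.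
Variable F : finFieldType.
Local Notation q := #|F|.
Local Notation Z := 'Z(SL2_group F)%g.
Local Notation Sq := (squares F).
Hypothesis char2 : 2%:R != 0 :> F.
Hypothesis odd_q : odd q.

Lemma card_squares : (2 * #|Sq| = q.+1)%N.
Proof.
have ge_q : (q <= 2 * #|Sq|)%N.
  rewrite -cardsT; apply: (@card_le_fibre _ _ setT Sq (fun s => s ^+ 2)) => [s _|t _].
    by apply/squaresP; exists s.
  apply: leq_trans (@card_horner_rec _ _ id [:: - t; 0; 1] 2 _ _ _); rewrite ?oner_neq0 //.
  by apply: subset_leq_card; apply/subsetP => s; rewrite !inE /= => /eqP <-; apply/eqP; ring.
apply/eqP; rewrite eqn_leq; apply/andP; split; last first.
  rewrite ltn_neqAle ge_q andbT; apply: contraTneq odd_q => ->.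
  by rewrite oddM.
have Sq0 : 0 \in Sq by apply/squaresP; exists 0; rewrite expr0n.
rewrite (cardsD1 0) Sq0 mulnDr add2n -(prednK (ltnW (card_F_gt1 F))) !ltnS.
rewrite mulnC -sum_nat_const -(cardC1 (0 : F)) -sum1_card.
rewrite [leqRHS](partition_big (fun s : F => s ^+ 2) (mem (Sq :\ 0))) => [|s]; last first.
  by rewrite inE => s0; rewrite !inE expf_eq0 /= s0; apply/existsP; exists s.
apply: leq_sum => t; rewrite in_setD1 => /andP[t0 /squaresP[s ts]].
have s0 : s != 0 by apply: contraNneq t0 => s0; rewrite ts s0 expr0n.
have ns : s != - s by rewrite -addr_eq0 -mulr2n -mulr_natr mulf_neq0.
have c2 : #|[set s; - s]| = 2%N by rewrite cards2 ns.
rewrite sum1dep_card -[leqLHS]c2.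
apply: subset_leq_card; apply/subsetP => r; rewrite !inE ts.
by case/orP => /eqP ->; rewrite ?sqrrN ?oppr_eq0 s0 ?eqxx.
Qed.

(** Pigeonhole: the sets of s^2 and of c - s^2 have (q + 1)/2 elements each, so they meet. *)
Lemma sum_two_squares (c : F) : exists r s, r ^+ 2 + s ^+ 2 = c.
Proof.
pose B := [set c - t | t in Sq].
have cB : #|B| = #|Sq| by apply: card_imset => t t' /addrI/oppr_inj.
have [t] : exists t, t \in Sq :&: B.
  apply/set0Pn; apply/negP => /eqP SB; have := cardsUI Sq B.
  rewrite SB cards0 addn0 cB addnn -mul2n card_squares => cU.
  by have := max_card (mem (Sq :|: B)); rewrite cU ltnn.
rewrite inE => /andP[/squaresP[r ->] /imsetP[t' /squaresP[s ->] e]]; exists r, s.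
by rewrite e subrK.
Qed.

(** The form c r^2 - 2a r s - b s^2 must represent 1. For c nonzero, multiplying by c and completing
    the square turns this into a sum of two squares equal to c, because -a^2 - bc = 1. For c = 0 it
    is linear in r at s = 1. *)
Lemma conj_companion_odd u : u \in SL2 F -> tr u = 0 ->
  exists2 w, w \in SL2 F & (u ^ w)%g = sl2 0 (-1) 1 (tr u).
Proof.
move=> Gu tu; have du := SL2_det Gu.
set a := GLval u 0 0 in du; set b := GLval u 0 1 in du; set c := GLval u 1 0 in du.
have da : GLval u 1 1 = - a.
  by apply/eqP; rewrite -addr_eq0 addrC -tr2E -/(tr u) tu.
rewrite da in du.
suff [r [s rs]] : exists r s, r * (c * r + - a * s) - s * (a * r + b * s) = 1.
  by apply: (@conj_companion _ _ r s) => //; rewrite da.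
have [c0 | c0] := eqVneq c 0.
  have a2 : a ^+ 2 = -1 by rewrite -du c0; ring.
  have a0 : a != 0 by apply: contra_eq_neq a2 => ->; rewrite expr0n /= eq_sym oppr_eq0 oner_eq0.
  exists (- (1 + b) / (2%:R * a)), 1; rewrite c0; field.
  by rewrite a0 char2.
have [r [s rs]] := sum_two_squares c.
exists (r / c + a / c * s), s.
transitivity ((r ^+ 2 + (- (a * a) - b * c) * s ^+ 2) / c); first by field.
have -> : - (a * a) - b * c = 1 by rewrite -du; ring.
by rewrite mul1r rs divff.
Qed.

(** If the image of x were the square of one of its powers, then x = e (x^n)^2 with e = 1 or -1, so
    tr x = e (t^2 - 2) for t = tr(x^n), and 2 + tr x or 2 - tr x would be the square t^2. Hence some
    noncentral power has a central square, and Cayley-Hamilton makes its trace 0. *)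
Lemma two_torsion_odd x : x \in SL2 F ->
    2%:R + tr x \notin Sq -> 2%:R - tr x \notin Sq ->
  exists n, [/\ (x ^+ n)%g \in SL2 F, (x ^+ n)%g \notin Z & tr (x ^+ n)%g = 0].
Proof.
move=> Gx n1 n2; have nZ := normal_norm (nsZSL2 F).
have nx i : (x ^+ i)%g \in 'N(Z)%g := subsetP nZ _ (SL2X i Gx).
have nx1 : x \in 'N(Z)%g := subsetP nZ _ Gx.
have [[n xn]|[n [xn2 xn1]]] := root_or_torsion (coset Z x) (isT : prime 2).
  have eqx : coset Z x = coset Z (x ^+ (n * 2))%g by rewrite morphX // expgM xn.
  have [z Zz xz] := coset_eq_mul nx1 (nx (n * 2)%N) eqx.
  have [e e2 ze] := center_scalar Zz.
  have txe : tr x = e * (tr (x ^+ n)%g ^+ 2 - 2%:R).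
    rewrite -tr_sqr; last exact: SL2X.
    by rewrite [in LHS]xz expgM /tr GLvalM ze mul_scalar_mx linearZ.
  have : (e - 1) * (e + 1) = 0 by transitivity (e ^+ 2 - 1); [ring | rewrite e2 subrr].
  move/eqP; rewrite mulf_eq0 subr_eq0 addr_eq0 => /orP[] /eqP ee.
    by case/negP: n1; apply/squaresP; exists (tr (x ^+ n)%g); rewrite txe ee; ring.
  by case/negP: n2; apply/squaresP; exists (tr (x ^+ n)%g); rewrite txe ee; ring.
have nZn : (x ^+ n)%g \notin Z.
  by apply: contra xn1 => Zxn; rewrite -morphX //; apply/eqP/coset_id.
exists n; split=> //; first exact: SL2X.
have Zxn2 : (x ^+ (n * 2))%g \in Z.
  by rewrite -(coset_eq1 (SL2X (n * 2) Gx)) morphX // expgM xn2.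
have [e e2 ze] := center_scalar Zxn2.
apply: (@tr_eq_scalar _ _ (1 + e)) => //; first exact: SL2X.
have := sqr_SL2 (SL2X n Gx); rewrite -expgM ze => h.
by rewrite -[LHS](subrK 1%:M) -h -raddfD addrC.
Qed.

(** A and B have (q + 1)/2 elements each, so the complement of their union has |A :&: B| - 1
    elements. *)
Lemma card_odd_bad :
  (q <= 4 * #|[set t : F | (2%:R + t \notin Sq)%R && (2%:R - t \notin Sq)%R]| + 6)%N.
Proof.
pose A := [set t : F | 2%:R + t \in Sq]; pose B := [set t : F | 2%:R - t \in Sq].
have cA : #|A| = #|Sq|.
  rewrite -(card_preimset Sq (addrI (2%:R : F))); apply: eq_card => t; by rewrite !inE.
have inj_m : injective (fun t : F => 2%:R - t) by move=> t t' /addrI/oppr_inj.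
have cB : #|B| = #|Sq| by rewrite -(card_preimset Sq inj_m); apply: eq_card => t; rewrite !inE.
have -> : [set t : F | (2%:R + t \notin Sq) && (2%:R - t \notin Sq)] = ~: (A :|: B).
  by apply/setP => t; rewrite in_setC in_setU negb_or !in_set.
have AB : (q <= 4 * #|A :&: B| + 2)%N.
  pose D := [set m : F | 1 + m ^+ 2 != 0].
  have cD : (q <= #|D| + 2)%N.
    rewrite -cardsT -(setUCr D) (leq_trans (leq_card_setU _ _)) // leq_add2l.
    apply: leq_trans (@card_horner_rec F F id [:: 1; 0; 1] 2 _ _ _); rewrite ?oner_neq0 //.
    apply: subset_leq_card; apply/subsetP => m; rewrite !inE negbK /= => /eqP m2; apply/eqP.
    by rewrite -[RHS]m2; ring.
  apply: leq_trans cD _; rewrite leq_add2r.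
  (* Writing 2 + t = s^2 and 2 - t = r^2 gives the conic s^2 + r^2 = 4, parametrised rationally by
     m; each t arises from at most 4 values of m. *)
  apply: (@card_le_fibre _ _ D (A :&: B) (fun m => (4%:R * m / (1 + m ^+ 2)) ^+ 2 - 2%:R)).
    move=> m; rewrite inE => m0; rewrite !in_set; apply/andP; split; apply/existsP.
      by exists (4%:R * m / (1 + m ^+ 2)); rewrite addrC subrK.
    exists (2%:R - 4%:R / (1 + m ^+ 2)); apply/eqP; field; exact: m0.
  move=> t _; have [t2 | t2] := eqVneq (t + 2%:R) 0.
    apply: (@leq_trans 1%N) => //; rewrite -[leqRHS](cards1 (0 : F)).
    apply: subset_leq_card; apply/subsetP => m; rewrite !inE => /andP[m0 /eqP mt].
    have : (4%:R * m / (1 + m ^+ 2)) ^+ 2 == 0.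
      by apply/eqP; transitivity (t + 2%:R); rewrite // -mt /= subrK.
    rewrite expf_eq0 /= mulf_eq0 invr_eq0 (negPf m0) orbF mulf_eq0.
    by rewrite -[4%N]/(2 * 2)%N natrM mulf_eq0 (negPf char2).
  apply: leq_trans (@card_horner_rec F F id
    [:: t + 2%:R; 0; 2%:R * (t + 2%:R) - 16%:R; 0; t + 2%:R] 4 _ _ _) => //.
  apply: subset_leq_card; apply/subsetP => m; rewrite !inE => /andP[m0 /eqP <-]; apply/eqP.
  by rewrite /=; field.
have := cardsUI A B; have : (#|A :|: B| + #|~: (A :|: B)|)%N = q := cardsC _.
rewrite cA cB; have := card_squares; move: AB.
by move: #|A :&: B| #|A :|: B| #|~: _| #|Sq| q => i u v s n; lia.
Qed.

End OddTorsion.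

(** * Traces of non-cubes in characteristic 2 *)

Section EvenCount.
Variable F : finFieldType.
Local Notation q := #|F|.
Hypothesis char2 : 2%:R = 0 :> F.

(** W is the set of points whose value under f is taken at least twice. At least |W| / 2 values are
    then missed, and |W| is about q / 2. *)
Lemma card_even_bad :
  (q <= 4 * #|~: [set (t ^+ 3 - 3%:R * t)%R | t in [set: F]]| + 6)%N.
Proof.
pose f (t : F) := t ^+ 3 - 3%:R * t.
pose W := [set t | [exists s, (s != t) && (f s == f t)]].
have cW : (q <= 2 * #|W| + 3)%N.
  pose D := [set m : F | (m != 0) && (1 + m + m ^+ 2 != 0)].
  have cD : (q <= #|D| + 3)%N.
    rewrite -cardsT -(setUCr D) (leq_trans (leq_card_setU _ _)) // leq_add2l.
    apply: leq_trans (@card_horner_rec F F id [:: 0; 1; 1; 1] 3 _ _ _); rewrite ?oner_neq0 //.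
    apply: subset_leq_card; apply/subsetP => m; rewrite !inE negb_and !negbK /= => /orP[] /eqP e.
      by apply/eqP; rewrite e; ring.
    by apply/eqP; transitivity (m * (1 + m + m ^+ 2)); [ring | rewrite e mulr0].
  apply: leq_trans cD _; rewrite leq_add2r.
  (* For s != t, f s = f t is the conic s^2 + st + t^2 = 1. The line s = m (t - 1) through its point
     (0, 1) meets it again at t = 1 + m / (1 + m + m^2); each t comes from at most two m. *)
  apply: (@card_le_fibre _ _ D W (fun m => 1 + m / (1 + m + m ^+ 2))).
    move=> m; rewrite !inE => /andP[m0 d0]; apply/existsP.
    exists (m * (m / (1 + m + m ^+ 2))); apply/andP; split.
      apply/negP => /eqP e; have : (1 + m + m ^+ 2) * (m * (m / (1 + m + m ^+ 2))) =
        (1 + m + m ^+ 2) * (1 + m / (1 + m + m ^+ 2)) by rewrite e.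
      move/eqP; rewrite -subr_eq0; apply/negP.
      have -> : (1 + m + m ^+ 2) * (m * (m / (1 + m + m ^+ 2))) -
        (1 + m + m ^+ 2) * (1 + m / (1 + m + m ^+ 2)) = - (1 + 2%:R * m) by field.
      by rewrite char2 mul0r addr0 oppr_eq0 oner_eq0.
    rewrite -subr_eq0; apply/eqP; rewrite /f.
    set k := m / _; have kE : k * (1 + m + m ^+ 2) = m by rewrite /k mulfVK.
    transitivity ((m * k - 1 - k) * (k * (k * (1 + m + m ^+ 2) + m) + 2%:R * (k - 1))); first by ring.
    by rewrite kE char2 mul0r addr0 -mulr2n -mulr_natr char2 !mulr0.
  move=> t _; have [t1|t1] := eqVneq (t - 1) 0.
    rewrite (_ : [set m in D | _] = set0) ?cards0 //; apply/setP => m; rewrite !inE.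
    apply/negP => /andP[/andP[m0 d0] /eqP mt].
    have : m / (1 + m + m ^+ 2) == 0.
      by apply/eqP; transitivity (t - 1); rewrite // -mt /= [RHS]addrC addKr.
    by rewrite mulf_eq0 invr_eq0 (negPf m0) (negPf d0).
  apply: leq_trans (@card_horner_rec F F id [:: t - 1; t - 1 - 1; t - 1] 2 _ _ _) => //.
  apply: subset_leq_card; apply/subsetP => m; rewrite !inE => /andP[/andP[m0 d0] /eqP <-].
  by apply/eqP; rewrite /=; field.
have fW : (2 * #|f @: W| <= #|W|)%N.
  rewrite mulnC -sum_nat_const -[leqRHS]sum1_card.
  rewrite [leqRHS](partition_big f (mem (f @: W))) => [|t Wt]; last exact: imset_f.
  apply: leq_sum => v /imsetP[t Wt ->]; rewrite sum1dep_card.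
  have := Wt; rewrite inE => /existsP[s /andP[st /eqP fst]].
  have c2 : #|[set s; t]| = 2%N by rewrite cards2 st.
  rewrite -[leqLHS]c2.
  apply: subset_leq_card; apply/subsetP => r; rewrite !inE => /orP[] /eqP ->.
    by rewrite fst eqxx andbT; apply/existsP; exists t; rewrite eq_sym st eqxx.
  by rewrite eqxx andbT; apply/existsP; exists s; rewrite st fst eqxx.
have fC : (#|f @: setT| <= #|f @: W| + #|~: W|)%N.
  rewrite -(setUCr W) imsetU (leq_trans (leq_card_setU _ _)) // leq_add2l.
  exact: leq_imset_card.
have : (#|f @: setT| + #|~: (f @: setT)|)%N = q := cardsC _.
have : (#|W| + #|~: W|)%N = q := cardsC _.
move: cW fW fC; rewrite -/f; move: #|f @: W| #|f @: setT| #|~: (f @: _)| #|~: W| #|W| q.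
by move=> a b c d e n; lia.
Qed.

End EvenCount.

(** Suitable powers of x1 and x2 are noncentral of the same trace, 1 in characteristic 2 and 0
    otherwise. Both are conjugate in SL2 to the same companion matrix, so the two Sigma sets share a
    nontrivial element. *)
Lemma shared_torsion (F : finFieldType) p k : prime p -> #|F| = (p ^ k)%N ->
  exists2 B : {set F}, (#|F| <= 4 * #|B| + 6)%N &
    forall x1 x2 y1 y2, x1 \in SL2 F -> x2 \in SL2 F -> tr x1 \in B -> tr x2 \in B ->
      unmixed_beauville (PSL2 F) (coset _ x1) y1 (coset _ x2) y2 = false.
Proof.
move=> pr_p Fpk; pose Z := 'Z(SL2_group F)%g; have nZ := normal_norm (nsZSL2 F).
have key x1 x2 y1 y2 i j : x1 \in SL2 F -> x2 \in SL2 F ->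
    (x1 ^+ i)%g \in SL2 F -> (x1 ^+ i)%g \notin Z ->
    (exists2 w, w \in SL2 F & (x2 ^+ j = (x1 ^+ i) ^ w)%g) ->
  unmixed_beauville (PSL2 F) (coset Z x1) y1 (coset Z x2) y2 = false.
  move=> Gx1 Gx2 Gi nZi [w Gw e].
  have Nx1 : x1 \in 'N(Z)%g := subsetP nZ _ Gx1.
  have Nx2 : x2 \in 'N(Z)%g := subsetP nZ _ Gx2.
  have Nw : w \in 'N(Z)%g := subsetP nZ _ Gw.
  apply: (@not_unmixed_beauville _ _ _ _ _ _ (coset Z w) i j); first exact: mem_quotient.
    by rewrite -morphX // coset_eq1.
  by rewrite -!morphX // e morphJ // (subsetP nZ).
have pF : p \in [pchar F] by apply: card_finPcharP Fpk pr_p.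
have [char2 | char2] := eqVneq (2%:R : F) 0.
  exists (~: [set t ^+ 3 - 3%:R * t | t in [set: F]]); first exact: card_even_bad.
  move=> x1 x2 y1 y2 Gx1 Gx2; rewrite !in_setC => t1 t2.
  have [i [Gi nZi ti]] := three_torsion_even char2 Gx1 t1.
  have [j [Gj nZj tj]] := three_torsion_even char2 Gx2 t2.
  apply: (key _ _ _ _ i j) => //; apply: conj_same_trace; last by rewrite ti tj.
    exact: conj_companion_even.
  exact: conj_companion_even.
have odd_q : odd #|F|.
  rewrite Fpk oddX; apply/orP; right; case: (even_prime pr_p) => // p2.
  by move: char2; rewrite -p2 (pcharf0 pF) eqxx.
exists [set t : F | (2%:R + t \notin squares F) && (2%:R - t \notin squares F)].
  exact: card_odd_bad.
move=> x1 x2 y1 y2 Gx1 Gx2; rewrite [tr x1 \in _]in_set [tr x2 \in _]in_set.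
move=> /andP[t1 t1'] /andP[t2 t2'].
have [i [Gi nZi ti]] := two_torsion_odd Gx1 t1 t1'.
have [j [Gj nZj tj]] := two_torsion_odd Gx2 t2 t2'.
apply: (key _ _ _ _ i j) => //; apply: conj_same_trace; last by rewrite ti tj.
  exact: conj_companion_odd.
exact: conj_companion_odd.
Qed.

(** * Counting quadruples by sums of indicators *)

Section FourfoldSums.
Variables (T : finType) (G : {set T}).
Local Open Scope nat_scope.
Implicit Types (f h : T -> T -> T -> T -> nat) (u v : T -> T -> nat).

Definition sum2s u := \sum_(x in G) \sum_(y in G) u x y.
Definition sum4 f := sum2s (fun x1 y1 => sum2s (f x1 y1)).

Lemma sum4_le f h : {in G & &, forall x1 y1 x2, {in G, forall y2, f x1 y1 x2 y2 <= h x1 y1 x2 y2}} ->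
  sum4 f <= sum4 h.
Proof.
move=> le_fh; apply: leq_sum => x1 Gx1; apply: leq_sum => y1 Gy1.
by apply: leq_sum => x2 Gx2; apply: leq_sum => y2; apply: le_fh.
Qed.

Lemma sum4D f h : sum4 (fun x1 y1 x2 y2 => f x1 y1 x2 y2 + h x1 y1 x2 y2) = sum4 f + sum4 h.
Proof.
rewrite -big_split; apply: eq_bigr => x1 _; rewrite -big_split; apply: eq_bigr => y1 _.
by rewrite -big_split; apply: eq_bigr => x2 _; rewrite -big_split.
Qed.

Lemma sum4M u v : sum4 (fun x1 y1 x2 y2 => u x1 y1 * v x2 y2) = sum2s u * sum2s v.
Proof.
rewrite big_distrl; apply: eq_bigr => x1 _; rewrite big_distrl; apply: eq_bigr => y1 _ /=.
by rewrite big_distrr; apply: eq_bigr => x2 _; rewrite big_distrr.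
Qed.

Lemma sum2s1 : sum2s (fun _ _ => 1) = #|G| ^ 2.
Proof. by rewrite -mulnn -[RHS]sum_nat_const; apply: eq_bigr => x _; rewrite sum1_card. Qed.

Lemma card_sum4 (P : T -> T -> T -> T -> bool) :
    (forall x1 y1 x2 y2, P x1 y1 x2 y2 -> [&& x1 \in G, y1 \in G, x2 \in G & y2 \in G]) ->
  #|[set t : T * T * T * T | let: (x1, y1, x2, y2) := t in P x1 y1 x2 y2]| =
  sum4 (fun x1 y1 x2 y2 => P x1 y1 x2 y2).
Proof.
move=> PG; rewrite /sum4 /sum2s pair_big /= pair_big /= pair_big /= -sum1dep_card.
rewrite big_mkcond [RHS]big_mkcond; apply: eq_bigr => -[[[x1 y1] x2] y2] _ /=.
case Pt: (P x1 y1 x2 y2); last by case: ifP.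
by case/and4P: (PG _ _ _ _ Pt) => -> -> -> ->.
Qed.

Lemma sum2s_mem (A : {set T * T}) : {in A, forall s, (s.1 \in G) && (s.2 \in G)} ->
  sum2s (fun x y => (x, y) \in A) = #|A|.
Proof.
move=> AG; rewrite /sum2s pair_big -sum1_card big_mkcond [RHS]big_mkcond.
apply: eq_bigr => -[x y] _ /=; case: (boolP ((x, y) \in A)) => [/AG /= ->|] //.
by case: ifP.
Qed.

Lemma sum2s_fst (A : {set T}) : A \subset G -> sum2s (fun x _ => x \in A) = #|G| * #|A|.
Proof.
move=> sAG; rewrite [RHS]mulnC -sum_nat_const /sum2s [LHS]big_mkcond [RHS]big_mkcond.
apply: eq_bigr => x _; rewrite sum_nat_const; case: (boolP (x \in A)) => [/(subsetP sAG) ->|_].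
  by rewrite muln1.
by rewrite muln0; case: ifP.
Qed.

End FourfoldSums.

Lemma sum4_quotient (gT : finGroupType) (G H : {group gT}) (f : coset_of H -> coset_of H -> coset_of H -> coset_of H -> nat) :
    (H <| G)%g ->
  (sum4 G (fun x1 y1 x2 y2 => f (coset H x1) (coset H y1) (coset H x2) (coset H y2)) =
   #|H| ^ 4 * sum4 (G / H)%g f)%N.
Proof.
move=> nHG; pose k := #|H|.
have sum2_quotient (h : coset_of H -> coset_of H -> nat) :
    (sum2s G (fun x y => h (coset H x) (coset H y)) = k ^ 2 * sum2s (G / H)%g h)%N.
  rewrite /sum2s (sum_quotient nHG (fun X => \sum_(y in G) h X (coset H y)))%N.
  rewrite -mulnn -mulnA; congr (_ * _)%N; rewrite big_distrr; apply: eq_bigr => X _.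
  exact: sum_quotient.
rewrite /sum4 (sum2_quotient (fun X Y => sum2s G (fun x y => f X Y (coset H x) (coset H y)))).
rewrite -[4%N]/(2 + 2)%N expnD -mulnA; congr (_ * _)%N.
rewrite /sum2s big_distrr; apply: eq_bigr => X _; rewrite big_distrr; apply: eq_bigr => Y _.
exact: sum2_quotient.
Qed.

(** * Bounds on the probability for a fixed field *)

Section Probability.
Variables (R : realFieldType) (F : finFieldType).
Local Notation q := #|F|.
Local Notation g := #|SL2 F|.
Local Notation Z := 'Z(SL2_group F)%g.

Definition lifted_beauville (x1 y1 x2 y2 : {'GL_2[F]}) :=
  unmixed_beauville (PSL2 F) (coset Z x1) (coset Z y1) (coset Z x2) (coset Z y2).

(** Every fibre of SL2 -> PSL2 has |Z| elements, so numerator and denominator both gain |Z|^4. *)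
Lemma beauville_prob_lift : beauville_prob R (PSL2 F) =
  (sum4 (SL2 F) lifted_beauville)%:R / g%:R ^+ 4.
Proof.
have -> : sum4 (SL2 F) lifted_beauville = (#|Z| ^ 4 * sum4 (PSL2 F) (unmixed_beauville (PSL2 F)))%N.
  exact: (sum4_quotient (fun X1 Y1 X2 Y2 => unmixed_beauville (PSL2 F) X1 Y1 X2 Y2) (nsZSL2 F)).
have -> : g = (#|Z| * #|PSL2 F|)%N.
  rewrite card_quotient ?(normal_norm (nsZSL2 F)) //.
  by rewrite (Lagrange (normal_sub (nsZSL2 F))).
rewrite /beauville_prob (@card_sum4 _ (PSL2 F)); last by move=> x1 y1 x2 y2 /and4P[].
have z0 : #|Z|%:R != 0 :> R by rewrite pnatr_eq0 -lt0n cardG_gt0.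
have p0 : #|PSL2 F|%:R != 0 :> R by rewrite pnatr_eq0 -lt0n cardG_gt0.
by rewrite !(natrX, natrM); field; rewrite z0 p0.
Qed.

(** The factor 2 counts the two orders, split pair first or nonsplit pair first, which are
    disjoint. *)
Lemma lifted_beauville_ge p k : prime p -> q = (p ^ k)%N ->
  (2 * #|closed_pairs (split_el F) :&: generating_pairs F|
     * #|closed_pairs (nonsplit_el F) :&: generating_pairs F|
   <= sum4 (SL2 F) lifted_beauville)%N.
Proof.
move=> pr_p qpk; set A := _ :&: _; set B := closed_pairs (nonsplit_el F) :&: _.
have pq : [pchar F].-nat q.
  have pF : p \in [pchar F] by apply: card_finPcharP qpk pr_p.
  by rewrite qpk pnatX pnatE // pF.
have AP s : s \in A -> [/\ s.1 \in split_el F, s.2 \in split_el F, (s.1 * s.2)%g \in split_el F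
    & <<[set s.1; s.2]>>%g = SL2 F].
  by rewrite in_setI 2![s \in _]in_set => /andP[/and3P[? ? ?] /eqP].
have BP s : s \in B -> [/\ s.1 \in nonsplit_el F, s.2 \in nonsplit_el F,
    (s.1 * s.2)%g \in nonsplit_el F & <<[set s.1; s.2]>>%g = SL2 F].
  by rewrite in_setI 2![s \in _]in_set => /andP[/and3P[? ? ?] /eqP].
have AB s : s \in A -> s \in B -> False.
  move=> /AP[+ _ _ _] /BP[+ _ _ _]; rewrite !inE => /andP[_ ->].
  by rewrite andbF.
have sG := subsetP (@split_el_sub F); have nG := subsetP (@nonsplit_el_sub F).
have AG : {in A, forall s, (s.1 \in SL2 F) && (s.2 \in SL2 F)}.
  by move=> s /AP[/sG -> /sG -> _ _].
have BG : {in B, forall s, (s.1 \in SL2 F) && (s.2 \in SL2 F)}.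
  by move=> s /BP[/nG -> /nG -> _ _].
have nZ := normal_norm (nsZSL2 F).
have cosetM x y : x \in SL2 F -> y \in SL2 F -> (coset Z x * coset Z y = coset Z (x * y))%g.
  by move=> Gx Gy; rewrite morphM // (subsetP nZ).
have GQ x : x \in SL2 F -> coset Z x \in PSL2 F by move=> Gx; apply: mem_quotient.
have gen s : (s.1 \in SL2 F) && (s.2 \in SL2 F) -> <<[set s.1; s.2]>>%g = SL2 F ->
    <<[set coset Z s.1; coset Z s.2]>>%g = PSL2 F.
  by move=> /andP[G1 G2] e; apply: (quotient_generate (nsZSL2 F)).
have A1 s : s \in A -> let a := (q.-1 %/ gcdn 2 q.-1)%N in
    [/\ coset Z s.1 ^+ a = 1, coset Z s.2 ^+ a = 1 & (coset Z s.1 * coset Z s.2) ^+ a = 1]%g.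
  move=> As a; have /andP[G1 G2] := AG s As; have [s1 s2 s3 _] := AP s As.
  by rewrite cosetM //; split; apply: split_expg.
have B1 s : s \in B -> let b := (q.+1 %/ gcdn 2 q.-1)%N in
    [/\ coset Z s.1 ^+ b = 1, coset Z s.2 ^+ b = 1 & (coset Z s.1 * coset Z s.2) ^+ b = 1]%g.
  move=> Bs b; have /andP[G1 G2] := BG s Bs; have [s1 s2 s3 _] := BP s Bs.
  by rewrite cosetM //; split; apply: nonsplit_expg.
have cop := coprime_torus F.
have BAB s s' : s \in A -> s' \in B -> lifted_beauville s.1 s.2 s'.1 s'.2.
  move=> As Bs'; have Gs := AG s As; have Gs' := BG s' Bs'.
  have /andP[? ?] := Gs; have /andP[? ?] := Gs'.
  apply: unmixed_beauville_coprime (A1 s As) (B1 s' Bs') cop; first by split; apply: GQ.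
    by apply: (gen s Gs); have [] := AP s As.
  by apply: (gen s' Gs'); have [] := BP s' Bs'.
have BBA s s' : s \in B -> s' \in A -> lifted_beauville s.1 s.2 s'.1 s'.2.
  move=> Bs As'; have Gs := BG s Bs; have Gs' := AG s' As'.
  have /andP[? ?] := Gs; have /andP[? ?] := Gs'; rewrite coprime_sym in cop.
  apply: unmixed_beauville_coprime (B1 s Bs) (A1 s' As') cop; first by split; apply: GQ.
    by apply: (gen s Gs); have [] := BP s Bs.
  by apply: (gen s' Gs'); have [] := AP s' As'.
rewrite -mulnA mul2n -addnn {2}[(#|A| * #|B|)%N]mulnC.
rewrite -(sum2s_mem AG) -(sum2s_mem BG) -!sum4M -sum4D.
apply: sum4_le => x1 y1 x2 _ _ _ y2 _.
case: (boolP ((x1, y1) \in A)) => A1'; case: (boolP ((x1, y1) \in B)) => B1'.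
- by case: (AB _ A1' B1').
- case: (boolP ((x2, y2) \in B)) => B2; last by rewrite !mul0n.
  by rewrite (BAB _ _ A1' B2).
- case: (boolP ((x2, y2) \in A)) => A2; last by rewrite !mul0n.
  by rewrite (BBA _ _ B1' A2).
by rewrite !mul0n.
Qed.

(** When x1 and x2 both have a shared-torsion trace the quadruple fails, whatever y1 and y2 are. *)
Lemma lifted_beauville_le p k : prime p -> q = (p ^ k)%N ->
  exists2 b, (q <= 4 * b + 6)%N &
    (sum4 (SL2 F) lifted_beauville + (g * (b * q * q.-1)) ^ 2 <= g ^ 4)%N.
Proof.
move=> pr_p qpk; have [B qB BB] := shared_torsion pr_p qpk; exists #|B| => //.
pose X := [set x in SL2 F | tr x \in B].
have sXG : X \subset SL2 F by apply/subsetP => x; rewrite inE => /andP[].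
have leX : (#|B| * q * q.-1 <= #|X|)%N := (card_trace_in B).1.
apply: (@leq_trans (sum4 (SL2 F) lifted_beauville + (g * #|X|) ^ 2)).
  by rewrite leq_add2l leq_sqr leq_mul2l leX orbT.
have -> : (g ^ 4 = g ^ 2 * g ^ 2)%N by rewrite -expnD.
rewrite -[((g * #|X|) ^ 2)%N]mulnn.
rewrite -(sum2s_fst sXG) -(sum2s1 (SL2 F)) -!sum4M -sum4D.
apply: sum4_le => x1 y1 x2 Gx1 _ Gx2 y2 _; rewrite /lifted_beauville.
case: (boolP (x1 \in X)) => X1; last by rewrite addn0 leq_b1.
case: (boolP (x2 \in X)) => X2; last by rewrite addn0 leq_b1.
move: X1 X2; rewrite [x1 \in X]in_set [x2 \in X]in_set => /andP[_ B1] /andP[_ B2].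
by rewrite (BB _ _ _ _ Gx1 Gx2 B1 B2).
Qed.

Lemma beauville_prob_bounds p k M (e : R) : prime p -> q = (p ^ k)%N ->
    (4 ^ 6 * q ^ 5 < M ^ 6)%N ->
    e = (193 + 16 * (size (divisors (q ^ 3 - q)) * M))%:R / q%:R ->
  1 / 32%:R - e <= beauville_prob R (PSL2 F) <= 15%:R / 16%:R + e.
Proof.
move=> pr_p qpk ltM; set K := (size _ * M)%N => eK; rewrite beauville_prob_lift.
set N := sum4 _ _.
have geN := lifted_beauville_ge pr_p qpk; have [b qb leN] := lifted_beauville_le pr_p qpk.
have geA := card_good_pairs_ge (@split_el_sub F) ltM (card_closed_split_ge F).
have geB := card_good_pairs_ge (@nonsplit_el_sub F) ltM (card_closed_nonsplit_ge F).
rewrite -/N in geN leN; move: geA geB geN.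
rewrite [in size _]card_SL2 -/K.
move: #|closed_pairs (split_el F) :&: _| #|closed_pairs (nonsplit_el F) :&: _| => A B geA geB geN.
have [Q2 gE _ _ _] := real_counts F R.
set Q := q%:R in Q2 gE eK *; pose D : R := (193 + 16 * K)%:R.
have D193 : 193%:R <= D by rewrite ler_nat leq_addr.
have Q0 : 0 < Q by lra.
have eE : e * Q = D by rewrite eK mulfVK // gt_eqF.
have e0 : 0 <= e by rewrite eK divr_ge0 ?ler0n.
have g0 : 0 < g%:R :> R by rewrite ltr0n cardG_gt0.
pose G : R := g%:R; rewrite -/G in gE g0 *.
have G4 : 0 < G ^+ 4 by rewrite exprn_gt0.
(* 193 = 97 + 96 covers both C = 11 and C = 97. With A and B both at least g^2 (1 - e) / 8, the
   probability is at least (1 - e)^2 / 32. *)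
have le_AD C (X : nat) : (C + 96 <= 193)%N ->
    (q * g ^ 2 <= 8 * q * X + (C + 96 + 16 * K) * g ^ 2)%N ->
    G ^+ 2 * (1 - e) <= 8%:R * X%:R.
  move=> leC leX; have : (q * g ^ 2 <= 8 * q * X + (193 + 16 * K) * g ^ 2)%N.
    by apply: leq_trans leX _; rewrite leq_add2l leq_mul2r leq_add2r leC orbT.
  rewrite -(ler_nat R) natrD !natrM -/D -/Q -/G -eE => h.
  rewrite -(ler_pM2l Q0); lra.
have {}geA := le_AD 11%N A isT geA; have {}geB := le_AD 97%N B isT geB.
apply/andP; split.
  rewrite ler_pdivlMr //; have [e1 | e1] := lerP 1 e.
    apply: (@le_trans _ _ 0); last exact: ler0n.
    by rewrite mulr_le0_ge0 ?(ltW G4) //; lra.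
  have h0 : 0 <= G ^+ 2 * (1 - e) by rewrite mulr_ge0 ?sqr_ge0 //; lra.
  have hAB := ler_pM h0 h0 geA geB.
  have {}geN : 2%:R * A%:R * B%:R <= N%:R :> R by rewrite -!natrM ler_nat.
  have h1 : 0 <= G ^+ 4 * e ^+ 2 by rewrite mulr_ge0 ?sqr_ge0 // ltW.
  have h2 : 0 <= G ^+ 4 * e by rewrite mulr_ge0 // ltW.
  move: hAB geN h1 h2; move: A%:R B%:R N%:R => x y n hAB geN h1 h2.
  have e4 : G ^+ 4 = G ^+ 2 * G ^+ 2 by rewrite -exprD.
  by rewrite e4 in h1 h2 *; lra.
rewrite ler_pdivrMr //; move: leN; rewrite -(ler_nat R) natrD !natrX !natrM.
rewrite -/G -/Q => leN.
have q1E : q.-1%:R = Q - 1 :> R.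
  by rewrite /Q -{2}(prednK (ltnW (card_F_gt1 F))) -natr1 addrK.
rewrite q1E in leN; have GE : G = Q * (Q - 1) * (Q + 1) by rewrite gE; ring.
have N0 : 0 <= (G * (b%:R * Q * (Q - 1))) ^+ 2 by apply: sqr_ge0.
(* For q <= 6 one has e >= 1 and the bound is trivial; beyond that, q - 6 <= 4b can be squared. *)
have [Q6 | Q6] := lerP Q 6.
  have e1 : 1 <= e.
    rewrite -(ler_pM2r Q0) eE mul1r; apply: le_trans Q6 _; apply: le_trans D193.
    by rewrite ler_nat.
  have : 0 <= G ^+ 4 * (e - 1) by rewrite mulr_ge0 ?(ltW G4) //; lra.
  by lra.
have bQ : Q - 6%:R <= 4%:R * b%:R by rewrite lerBlDr -natrM -natrD ler_nat.
pose c := G * (Q * (Q - 1)).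
have c0 : 0 <= c by rewrite /c !mulr_ge0 ?(ltW g0) ?(ltW Q0) //; lra.
have h1 : (c * (Q - 6%:R)) ^+ 2 <= (c * (4%:R * b%:R)) ^+ 2.
  by apply: lerXn2r; rewrite ?nnegrE ?mulr_ge0 ?ler0n ?ler_wpM2l //; lra.
(* 14 = 12 + 2 makes the quadratic terms of the two cubics agree; the failure probability is thus at
   least (1 - 14/q) / 16. *)
have h2 : c ^+ 2 * ((Q + 1) ^+ 2 * (Q - 14%:R)) <= c ^+ 2 * (Q * (Q - 6%:R) ^+ 2).
  rewrite ler_wpM2l ?sqr_ge0 //; nra.
have G4E : G ^+ 4 = c ^+ 2 * (Q + 1) ^+ 2.
  have GG : G * G = c * (Q + 1) by rewrite /c {2}GE; ring.
  by rewrite -exprMn -GG; ring.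
have h3 : 0 <= G ^+ 4 * (e * Q - 14%:R) by rewrite mulr_ge0 ?(ltW G4) // eE; lra.
have h4 : G ^+ 4 * (Q - 14%:R) <= 16%:R * ((G * (b%:R * Q * (Q - 1))) ^+ 2 * Q).
  apply: (@le_trans _ _ (c ^+ 2 * (Q * (Q - 6%:R) ^+ 2))); first by rewrite G4E -mulrA.
  have -> : c ^+ 2 * (Q * (Q - 6%:R) ^+ 2) = (c * (Q - 6%:R)) ^+ 2 * Q by ring.
  have -> : 16%:R * ((G * (b%:R * Q * (Q - 1))) ^+ 2 * Q) = (c * (4%:R * b%:R)) ^+ 2 * Q.
    by rewrite /c; ring.
  by rewrite ler_wpM2r // ltW.
rewrite -(ler_pM2r Q0); have h5 := ler_wpM2r (ltW Q0) leN.
move: h3 h4 h5 (ltW G4); move: (G ^+ 4) ((G * _) ^+ 2) N%:R => w a n h3 h4 h5 w0.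
by clear -h3 h4 h5 w0; lra.
Qed.

End Probability.

(** * The error term tends to 0 *)

Lemma sixth_power_witness q : exists M, (4 ^ 6 * q ^ 5 < M ^ 6)%N.
Proof.
exists (4 * q.+1)%N; rewrite expnMn ltn_mul2l expn_gt0 /=.
by apply: (@leq_ltn_trans (q ^ 6)%N); [case: q => // q; rewrite leq_pexp2l | rewrite ltn_exp2r].
Qed.

(** The order threshold, about 4 q^(5/6). *)
Definition least_order q := ex_minn (sixth_power_witness q).

Lemma least_order_gt q : (4 ^ 6 * q ^ 5 < least_order q ^ 6)%N.
Proof. by rewrite /least_order; case: ex_minnP. Qed.

Lemma least_order_le q : (0 < q)%N -> (least_order q ^ 6 <= 8 ^ 6 * q ^ 5)%N.
Proof.
move=> q0; rewrite /least_order; case: ex_minnP => M ltM minM.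
have M2 : (2 <= M)%N.
  rewrite leqNgt; apply/negP => M1; move: ltM; rewrite ltnNge => /negP[].
  apply: (@leq_trans (1 ^ 6)%N); first by rewrite leq_exp2r.
  by rewrite exp1n muln_gt0 !expn_gt0 q0.
have leM : (M.-1 ^ 6 <= 4 ^ 6 * q ^ 5)%N.
  rewrite leqNgt; apply/negP => /minM; rewrite leqNgt => /negP; apply.
  by rewrite prednK // ltnW.
apply: (@leq_trans ((2 * M.-1) ^ 6)); first by rewrite leq_exp2r //; lia.
by rewrite expnMn -[8%N]/(2 * 4)%N [((2 * 4) ^ 6)%N]expnMn -mulnA leq_mul2l leM orbT.
Qed.

Definition error_num q := (size (divisors (q ^ 3 - q)) * least_order q)%N.

(** The 24th power of the divisor count is O(q^3) and that of the threshold is O(q^20), so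
    [error_num q] is O(q^(23/24)). The exponent 24 is the least multiple of 6 for which the total
    degree stays below it. *)
Lemma error_num_le : exists c, forall q, (1 < q)%N -> (error_num q ^ 24 <= c * q ^ 23)%N.
Proof.
have [c leC] := @size_divisors_exp_le 24 isT; exists (c * (8 ^ 6) ^ 4)%N => q q1.
have q3 : (0 < q ^ 3 - q)%N by rewrite subn_gt0 -{1}[q]expn1 ltn_exp2l.
rewrite /error_num expnMn -[24%N in X in (_ * X <= _)%N]/(6 * 4)%N [(least_order q ^ _)%N]expnM.
apply: (@leq_trans (c * q ^ 3 * (8 ^ 6 * q ^ 5) ^ 4)).
  apply: leq_mul; last by rewrite leq_exp2r // least_order_le // ltnW.
  by apply: leq_trans (leC _ q3) _; rewrite leq_mul2l leq_subr orbT.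
by rewrite [((8 ^ 6 * _) ^ 4)%N]expnMn -(expnM q) mulnACA -expnD.
Qed.

From mathcomp Require Import all_classical all_reals all_analysis.
Import numFieldNormedType.Exports.
Local Open Scope classical_set_scope.

Lemma error_num_cvg (R : realType) :
  ((error_num q)%:R / q%:R : R) @[q --> \oo] --> (0 : R).
Proof.
have [c leC] := error_num_le; apply/cvgr0Pnorm_lt => e e0.
near=> q.
have q1 : (1 < q)%N by near: q; exists 2%N.
have Q0 : 0 < q%:R :> R by rewrite ltr0n ltnW.
have x0 : 0 <= (error_num q)%:R / q%:R :> R by rewrite divr_ge0 ?ler0n.
rewrite ger0_norm // -(@ltr_pXn2r _ 24) ?nnegrE // ?ltW //.
rewrite exprMn exprVn ltr_pdivrMr ?exprn_gt0 // -natrX.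
apply: (@le_lt_trans _ _ (c%:R * q%:R ^+ 23)).
  by rewrite -natrX -natrM ler_nat leC.
have -> : e ^+ 24 * q%:R ^+ 24 = (e ^+ 24 * q%:R) * q%:R ^+ 23 by rewrite -mulrA -exprS.
rewrite ltr_pM2r ?exprn_gt0 //.
rewrite -ltr_pdivrMl ?exprn_gt0 //.
near: q; exact: nbhs_infty_gtr.
Unshelve. all: by end_near. Qed.

Lemma natinv_cvg (R : realType) : ((q%:R)^-1 : R) @[q --> \oo] --> (0 : R).
Proof.
apply/cvgr0Pnorm_lt => e e0; near=> q.
have Q0 : 0 < q%:R :> R by rewrite ltr0n; near: q; exists 1%N.
rewrite ger0_norm ?invr_ge0 ?ler0n // invf_plt //.
by near: q; exact: nbhs_infty_gtr.
Unshelve. all: by end_near. Qed.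

Theorem theorem7 (R : realType) :
  exists2 eps : nat -> R,
    eps q @[q --> within prime_power \oo] --> (0 : R) &
    forall q : nat, prime_power q ->
    forall F : finFieldType, #|F| = q ->
      (odd q ->
         1 / 32 - eps q <= beauville_prob R (PSL2 F) <= 15 / 16 + eps q) /\
      (~~ odd q ->
         1 / 32 - eps q <= beauville_prob R (PSL2 F) <= 35 / 36 + eps q).
Proof.
exists (fun q => (193 + 16 * error_num q)%:R / q%:R).
  (* Convergence is proved along all naturals, which is stronger than along prime powers. *)
  apply: cvg_trans (cvg_app _ (cvg_within _)) _.
  have -> : (fun q => (193 + 16 * error_num q)%:R / q%:R : R) =
     (fun q => 193%:R * (q%:R)^-1 + 16%:R * ((error_num q)%:R / q%:R)).
    by apply/funext => q; rewrite natrD natrM mulrDl mulrA.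
  have cst (c : R) : (fun _ : nat => c) @ \oo --> c by exact: cvg_cst.
  have := cvgD (cvgM (cst 193%:R) (@natinv_cvg R)) (cvgM (cst 16%:R) (@error_num_cvg R)).
  by rewrite !mulr0 addr0; apply; exact: eventually_filter.
move=> _ [p [k [pr_p k0 ->]]] F cF.
have := @beauville_prob_bounds R F p k (least_order (p ^ k)) _ pr_p cF; rewrite cF.
move=> /(_ _ (least_order_gt _) erefl); rewrite -/(error_num _) => /andP[lo hi].
split=> _; first by rewrite lo.
(* The bound 15/16 holds for even q as well and is below 35/36. *)
by rewrite lo /=; apply: le_trans hi _; rewrite lerD2r; lra.
Qed.
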